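(* Let $\mathcal{H}$ be a complex Hilbert space, let $\mathcal{B}(\mathcal{H})$ be the algebra of all bounded linear operators on $\mathcal{H}$, let $\mathcal{A}\subseteq\mathcal{B}(\mathcal{H})$ be a von Neumann algebra without central summands of type $I_1$, and let $n\geq 2$ be a fixed integer. Then a mapping $\delta:\mathcal{A}\longrightarrow\mathcal{B}(\mathcal{H})$ (not assumed to be additive or linear) satisfies $$ \delta(p_n(A_1,A_2,\dots,A_n))=\sum_{k=1}^n p_n(A_1,\dots,A_{k-1},\delta(A_k),A_{k+1},\dots,A_n) $$ for all $A_1,A_2,\dots,A_n\in\mathcal{A}$ if and only if $\delta$ is an additive $\ast$-derivation.
   Context: A von Neumann algebra on $\mathcal{H}$ is a weakly closed, self-adjoint algebra of operators on $\mathcal{H}$ containing the identity operator $I$. For $A,B\in\mathcal{B}(\mathcal{H})$ the $\ast$-Jordan product is $A\diamond B=AB+BA^{\ast}$, where $A^\ast$ is the adjoint of $A$. This product is in general neither associative nor commutative. The polynomials $p_n$ are defined recursively by $p_1(x_1)=x_1$ and $p_n(x_1,\dots,x_n)=p_{n-1}(x_1,\dots,x_{n-1})\diamond x_n$ for $n\geq 2$, i.e. $p_n(x_1,\dots,x_n)=(\cdots((x_1\diamond x_2)\diamond x_3)\diamond\cdots\diamond x_{n-1})\diamond x_n$. They are evaluated on elements of $\mathcal{B}(\mathcal{H})$. A mapping $\delta:\mathcal{A}\to\mathcal{B}(\mathcal{H})$ is an additive $\ast$-derivation if it is additive ($\delta(A+B)=\delta(A)+\delta(B)$), satisfies $\delta(AB)=\delta(A)B+A\delta(B)$,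 and satisfies $\delta(A^{\ast})=\delta(A)^{\ast}$, for all $A,B\in\mathcal{A}$. No complex-homogeneity is required. *)

(* Defs.v *)
From HB Require Import structures.
From mathcomp Require Import all_boot all_order all_algebra.
From mathcomp Require Import all_classical all_reals.
From mathcomp Require Import topology normedtype.
From mathcomp Require Import complex.
From mathcomp Require Import ring lra.
Set Implicit Arguments.
Unset Strict Implicit.
Unset Printing Implicit Defensive.
Import Order.TTheory GRing.Theory Num.Theory numFieldNormedType.Exports.
Local Open Scope classical_set_scope.
Local Open Scope complex_scope.
Local Open Scope ring_scope.

(* {dot H for conjC} is linear in its first argument and conjugate-linear in
   the second one. *)
HB.mixin Record CompleteNormedModule_isHilbert (R : realType) H
    of CompleteNormedModule R[i] H := {
  inner : {dot H for @Num.conj R[i]};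
  normr_inner : forall x : H, `|x| ^+ 2 = inner x x
}.

#[short(type="hilbertType")]
HB.structure Definition Hilbert (R : realType) :=
  {H of CompleteNormedModule R[i] H & CompleteNormedModule_isHilbert R H}.

Local Notation "''[' u , v ]" := (inner u v) : ring_scope.

Lemma Re_conj (R : realType) (z : R[i]) :
  complex.Re (Num.conj z) = complex.Re z.
Proof. by case: z. Qed.

Lemma Re_realM (R : realType) (t : R) (z : R[i]) :
  complex.Re (t%:C * z) = t * complex.Re z.
Proof. by case: z => a b /=; rewrite mul0r subr0. Qed.

Lemma ge0_ReE (R : realType) (z : R[i]) : 0 <= z -> z = (complex.Re z)%:C.
Proof. by case: z => a b; rewrite lecE /= => /andP[/eqP -> _]. Qed.

Lemma Re_i_inj (R : realType) (z w : R[i]) :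
  complex.Re ('i * z) = complex.Re ('i * w) -> complex.Re z = complex.Re w ->
  w = z.
Proof.
case: z w => a b [c d] /=.
by rewrite !mul0r !mul1r !sub0r => /oppr_inj -> ->.
Qed.

Lemma sqr_Re_le (R : realType) (z : R[i]) :
  (complex.Re z ^+ 2)%:C <= `|z| ^+ 2.
Proof. by rewrite -add_Re2_Im2 lecR lerDl sqr_ge0. Qed.

Section RealInner.
Variables (R : realType) (H : hilbertType R).
Implicit Types (x y z : H) (t : R).

Let rip x y : R := complex.Re '[x, y].
Let q x : R := rip x x.

Let ripDl x y z : rip (x + y) z = rip x z + rip y z.
Proof. by rewrite /rip linearDl raddfD. Qed.

Let ripC x y : rip x y = rip y x.
Proof.
rewrite /rip hermitian_subproof expr0 mul1r.
exact: Re_conj.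
Qed.

Let ripDr x y z : rip z (x + y) = rip z x + rip z y.
Proof. by rewrite ripC ripDl !(ripC _ z). Qed.

Let ripZl t x y : rip (t%:C *: x) y = t * rip x y.
Proof.
by rewrite /rip linearZl_LR; exact: Re_realM.
Qed.

Let ripZr t x y : rip x (t%:C *: y) = t * rip x y.
Proof. by rewrite ripC ripZl ripC. Qed.

Let qE x : '[x, x] = (q x)%:C.
Proof.
exact/ge0_ReE/dnorm_ge0.
Qed.

Let q_ge0 x : 0 <= q x.
Proof. by have := dnorm_ge0 (@inner R H) x; rewrite qE lecR. Qed.

Let normq x : `|x| ^+ 2 = (q x)%:C.
Proof. by rewrite normr_inner qE. Qed.

Let q_eq0 x : q x = 0 -> x = 0.
Proof.
move=> q0; have := normq x; rewrite q0 => /eqP.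
by rewrite expf_eq0 /= normr_eq0 => /eqP.
Qed.

Let normq_lt x (e : R) : 0 < e -> (`|x| < e%:C) = (q x < e ^+ 2).
Proof.
move=> e0; have e1 : 0 <= e%:C by rewrite lecE /= eqxx ltW.
by rewrite -(@ltr_pXn2r _ 2) ?nnegrE // normq -rmorphXn ltcR.
Qed.

Let rip_CS x y : rip x y ^+ 2 <= q x * q y.
Proof.
have [/q_eq0 ->|qx0] := eqVneq (q x) 0.
  have rip0 z : rip 0 z = 0.
    by rewrite -(scale0r 0) -(rmorph0 (real_complex R)) ripZl mul0r.
  by rewrite /q !rip0 mul0r expr0n.
have := q_ge0 ((q x)%:C *: y + (- rip x y)%:C *: x).
rewrite /q !(ripDl, ripDr, ripZl, ripZr) (ripC y x) -/(q x) -/(q y).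
set a := q x; set b := q y; set c := rip x y => h.
have {}h : 0 <= a * (a * b - c ^+ 2).
  apply: le_trans h _; rewrite le_eqVlt; apply/orP; left; apply/eqP; ring.
by rewrite pmulr_rge0 ?subr_ge0 // lt_neqAle eq_sym qx0 q_ge0 in h.
Qed.

Lemma cauchy_schwarz x y : `|'[x, y]| <= `|x| * `|y|.
Proof.
rewrite -(@ler_pXn2r _ 2) ?nnegrE ?mulr_ge0 // exprMn !normq.
pose c := '[x, y]; pose n := complex.Re (`|c| ^+ 2).
have cn : `|c| ^+ 2 = n%:C by apply: ge0_ReE; rewrite exprn_ge0.
have n0 : 0 <= n by rewrite -lecR -cn exprn_ge0.
have : rip x (c *: y) = n.
  by rewrite /rip linearZr_LR /= -/c mulrC -normCK cn.
have : q (c *: y) = n * q y.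
  rewrite /q {1}/rip linearZr_LR linearZl_LR /= mulrCA mulrA -normCK cn.
  exact: Re_realM.
have := rip_CS x (c *: y) => /[swap] -> /[swap] ->.
rewrite -/c cn -(rmorphM (real_complex R)) lecR.
have [->|nn0] := eqVneq n 0; first by rewrite mulr_ge0.
by rewrite mulrCA expr2 ler_pM2l // lt_neqAle eq_sym nn0.
Qed.

Lemma riesz (f : {linear H -> R[i]^o}) (M : R[i]) :
  (forall x, `|f x| <= M * `|x|) -> exists y, forall x, f x = '[x, y].
Proof.
move=> fM.
pose F x : R := complex.Re (f x).
have FD x y : F (x + y) = F x + F y by rewrite /F !raddfD.
have FZ t x : F (t%:C *: x) = t * F x.
  by rewrite /F linearZ; exact: Re_realM.
have [K K0 FK] : exists2 K : R, 0 <= K & forall x, F x ^+ 2 <= K * q x.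
  exists (complex.Re M ^+ 2); rewrite ?sqr_ge0 // => x.
  have [->|x0] := eqVneq x 0.
    by rewrite /F linear0 /= expr0n mulr_ge0 ?sqr_ge0 ?q_ge0.
  have M0 : 0 <= M.
    have := le_trans (normr_ge0 _) (fM x).
    by rewrite pmulr_lge0 // normr_gt0.
  have : `|f x| ^+ 2 <= (M * `|x|) ^+ 2.
    by rewrite ler_pXn2r ?nnegrE // mulr_ge0.
  rewrite exprMn normq => h; have := le_trans (sqr_Re_le (f x)) h.
  by rewrite (ge0_ReE M0) -(rmorphXn (real_complex R)) -rmorphM lecR.
pose J x := q x - F x *+ 2.
have JK x : - K <= J x.
  have h1 := FK x; have h2 := q_ge0 x; rewrite /J mulr2n.
  rewrite leNgt; apply/negP => h; set a := q x in h h1 h2; set b := F x in h h1.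
  have : 0 < (b + b - a - K) * (b + b + a + K) by apply: mulr_gt0; lra.
  have := sqr_ge0 (a - K); nra.
have infJ : has_inf (range J).
  by split; [exists (J 0), 0|exists (- K) => _ [x _ <-]].
pose m := inf (range J).
have mJ x : m <= J x by apply: (ge_inf infJ.2); exists x.
pose S (e : R) := [set x | J x < m + e].
have Sne e : 0 < e -> S e !=set0.
  by move=> e0; have [_ [x _ <-] h] := inf_adherent e0 infJ; exists x.
have SP e x z : S e x -> (rip x z - F z) ^+ 2 <= e * q z.
  rewrite /S /= => Sx.
  have e0 : 0 < e by have := mJ x; lra.
  have [/q_eq0 ->|qz0] := eqVneq (q z) 0.
    have -> : rip x 0 = 0.
      by rewrite ripC -(scale0r 0) -(rmorph0 (real_complex R)) ripZl mul0r.
    by rewrite /F linear0 subrr expr0n mulr_ge0 ?q_ge0 // ltW.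
  have qz : 0 < q z by rewrite lt_neqAle eq_sym qz0 q_ge0.
  set c := rip x z - F z.
  have := mJ (x + (- c / q z)%:C *: z).
  rewrite /J FD FZ /q !(ripDl, ripDr, ripZl, ripZr) (ripC z x).
  rewrite -/(q x) -/(q z) => h.
  have {}h : - e < - (c ^+ 2 / q z).
    suff : J x - (c ^+ 2 / q z) >= m by lra.
    apply: le_trans h _; rewrite /J /c le_eqVlt.
    by apply/orP; left; apply/eqP; field.
  by rewrite -ler_pdivrMr //; lra.
have Sdist e x y : S e x -> S e y -> q (x - y) < e *+ 4.
  rewrite /S /= => Sx Sy.
  have := mJ ((2^-1)%:C *: (x + y)).
  have -> : x - y = x + (-1)%:C *: y.
    by rewrite (rmorphN (real_complex R)) rmorph1 scaleN1r.
  move: Sx Sy; rewrite /J FZ FD /q !(ripDl, ripDr, ripZl, ripZr) (ripC y x).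
  by rewrite -!/(q _); lra.
pose G := filter_from [set e : R | 0 < e] S.
have GP : ProperFilter G.
  apply: filter_from_proper => //.
  apply: filter_from_filter; first by exists 1 => /=.
  move=> e1 e2 e10 e20; exists (Num.min e1 e2); first by rewrite /= lt_min e10.
  move=> x; rewrite /S /= => h.
  by split; apply: (lt_le_trans h); rewrite lerD2l ge_min lexx ?orbT.
have : cvg G.
  apply: cauchy_cvg; apply/cauchy_ballP => e e0.
  have [r r0 ->] : exists2 r : R, 0 < r & e = r%:C.
    by move: e0; case: e => a b; rewrite ltcE /= => /andP[/eqP -> ?]; exists a.
  exists (S (r ^+ 2 / 4), S (r ^+ 2 / 4)).
    by split; exists (r ^+ 2 / 4) => //=; rewrite divr_gt0 ?exprn_gt0.
  move=> [x y] [/= Sx Sy]; rewrite -ball_normE /= normq_lt //.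
  by have := Sdist _ _ _ Sx Sy; lra.
set y := lim G => Gy.
have key z : rip y z = F z.
  apply/eqP; rewrite -subr_eq0 -sqrf_eq0 eq_le sqr_ge0 andbT.
  apply/ler_addgt0Pl => d d0; rewrite addr0.
  pose e := d / (2 * (q z + 1)).
  have z0 : 0 < q z + 1 by rewrite ltr_wpDl ?q_ge0.
  have e0 : 0 < e by rewrite /e divr_gt0 // mulr_gt0.
  have s0 : 0 < Num.sqrt (e/2) by rewrite sqrtr_gt0; lra.
  have : G (ball y (Num.sqrt (e/2))%:C).
    by apply: Gy; apply: nbhsx_ballx; rewrite ltcE /= eqxx.
  move=> [e1 e10 Sb].
  have [x Sx] := Sne (Num.min e1 (e/2)) ltac:(rewrite lt_min e10; lra).
  have h1 : q (y - x) < e/2.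
    rewrite -[ltRHS](@sqr_sqrtr _ (e/2)); last lra.
    have /Sb : S e1 x.
      move: Sx; rewrite /S /= => h; apply: lt_le_trans h _.
      by rewrite lerD2l ge_min lexx.
    by rewrite -ball_normE /= normq_lt.
  have h2 := SP _ _ z Sx.
  have {}h2 : (rip x z - F z) ^+ 2 <= e/2 * q z.
    by apply: le_trans h2 _; rewrite ler_wpM2r ?q_ge0 // ge_min lexx orbT.
  have h3 := rip_CS (y - x) z.
  have {h1}h3 : rip (y - x) z ^+ 2 <= e/2 * q z.
    by apply: le_trans h3 _; rewrite ler_wpM2r ?q_ge0 // ltW.
  have -> : rip y z = rip (y - x) z + rip x z by rewrite -ripDl subrK.
  have h4 := sqr_ge0 (rip (y - x) z - (rip x z - F z)).
  have h5 : e * (q z + 1) * 2 = d by rewrite /e; field; rewrite gt_eqF.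
  nra.
exists y => x.
have := key x; have := key ('i *: x).
rewrite !(ripC y) /rip /F linearZl_LR linearZ /=.
exact: Re_i_inj.
Qed.

End RealInner.

Section BoundedOperators.
Variables (R : realType) (H : hilbertType R).

Definition bounded_linear : {pred H -> H} := fun f =>
  `[< linear f /\ exists M : R[i], forall x, `|f x| <= M * `|x| >].

Lemma bounded_linear_submod : submod_closed bounded_linear.
Proof.
split.
  apply/asboolP; split; first by move=> c x y; rewrite /= scaler0 addr0.
  by exists 0 => x; rewrite normr0 mul0r.
move=> c f g /asboolP[lf [M fM]] /asboolP[lg [N gN]]; apply/asboolP; split.
  move=> a x y; rewrite !fctE /= lf lg !scalerDr !scalerA (mulrC a).
  by rewrite addrACA.
exists (`|c| * M + N) => x; rewrite mulrDl (le_trans (ler_normD _ _)) //.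
by rewrite lerD ?gN // normrZ -mulrA ler_wpM2l.
Qed.

HB.instance Definition _ :=
  GRing.isSubmodClosed.Build R[i] (H -> H) bounded_linear bounded_linear_submod.

Record boundedOp := BoundedOp {
  bop_fun :> H -> H;
  bop_subproof : bop_fun \in bounded_linear
}.

HB.instance Definition _ := [isSub for bop_fun].
HB.instance Definition _ := [Choice of boundedOp by <:].
HB.instance Definition _ := [SubChoice_isSubLmodule of boundedOp by <:].

Lemma bop_linear (A : boundedOp) : linear A.
Proof. by case: A => f /= /asboolP[]. Qed.

HB.instance Definition _ (A : boundedOp) :=
  GRing.isLinear.Build R[i] H H *:%R A (bop_linear A).

Lemma bop_bounded (A : boundedOp) :
  exists M : R[i], forall x, `|A x| <= M * `|x|.
Proof. by case: A => f /= /asboolP[]. Qed.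

Lemma bopP (A B : boundedOp) : A =1 B -> A = B.
Proof. by move=> AB; apply/val_inj/funext. Qed.

Lemma bounded_linear_id : (idfun : H -> H) \in bounded_linear.
Proof.
by apply/asboolP; split => //; exists 1 => x; rewrite mul1r.
Qed.

Lemma bounded_linear_comp (A B : boundedOp) : A \o B \in bounded_linear.
Proof.
apply/asboolP; split; first by move=> c x y; rewrite /= !linearP.
have [M AM] := bop_bounded A; have [N BN] := bop_bounded B.
exists (`|M| * N) => x /=.
apply: (@le_trans _ _ (`|M| * `|B x|)); last by rewrite -mulrA ler_wpM2l.
apply: le_trans (AM _) _.
have [->|Bx0] := eqVneq (B x) 0; first by rewrite normr0 !mulr0.
have := le_trans (normr_ge0 _) (AM (B x)).
by rewrite pmulr_lge0 ?normr_gt0 // => M0; rewrite ger0_norm.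
Qed.

Definition bop_one : boundedOp := BoundedOp bounded_linear_id.
Definition bop_mul (A B : boundedOp) : boundedOp :=
  BoundedOp (bounded_linear_comp A B).

Lemma bop_mulA : associative bop_mul. Proof. by move=> A B C; apply: bopP. Qed.
Lemma bop_mul1 : left_id bop_one bop_mul. Proof. by move=> A; apply: bopP. Qed.
Lemma bop_mulr1 : right_id bop_one bop_mul.
Proof. by move=> A; apply: bopP. Qed.
Lemma bop_mulDl : left_distributive bop_mul +%R.
Proof. by move=> A B C; apply: bopP. Qed.
Lemma bop_mulDr : right_distributive bop_mul +%R.
Proof. by move=> A B C; apply: bopP => x; rewrite /= linearD. Qed.

(* Only a pzRingType: H is allowed to be the zero space. *)
HB.instance Definition _ := GRing.Zmodule_isPzRing.Build boundedOp
  bop_mulA bop_mul1 bop_mulr1 bop_mulDl bop_mulDr.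

End BoundedOperators.

Notation "''B' ( H )" := (boundedOp H) (at level 0, format "''B' ( H )").

Section Adjoint.
Variables (R : realType) (H : hilbertType R).
Implicit Types (x y : H) (A B : 'B(H)).

Lemma innerC x y : '[x, y] = Num.conj '[y, x].
Proof. by rewrite hermitian_subproof expr0 mul1r. Qed.

Lemma innerDl x y z : '[x + y, z] = '[x, z] + '[y, z].
Proof. by rewrite linearDl. Qed.

Lemma innerZl (c : R[i]) x y : '[c *: x, y] = c * '[x, y].
Proof. by rewrite linearZl_LR. Qed.

Lemma innerDr x y z : '[x, y + z] = '[x, y] + '[x, z].
Proof. by rewrite linearDr. Qed.

Lemma innerZr (c : R[i]) x y : '[x, c *: y] = Num.conj c * '[x, y].
Proof. by rewrite linearZr_LR. Qed.

Lemma innerl_inj x y : (forall z, '[z, x] = '[z, y]) -> x = y.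
Proof.
move=> xy; apply/eqP; rewrite -subr_eq0 -(dnorm_eq0 (@inner R H)).
by rewrite linearBr subr_eq0; apply/eqP; exact: xy.
Qed.

Lemma adjoint_ex A : exists B, forall x y, '[A x, y] = '[x, B y].
Proof.
have [M AM] := bop_bounded A.
have [g gP] : {g : H -> H & forall y x, '[A x, y] = '[x, g y]}.
  apply: (@choice H H (fun y z => forall x, '[A x, y] = '[x, z])) => y.
  have fl : linear (fun x => '[A x, y] : R[i]^o).
    by move=> c u v; rewrite linearP innerDl innerZl.
  pose f : {linear H -> R[i]^o} :=
    HB.pack (fun x => '[A x, y] : R[i]^o) (GRing.isLinear.Build _ _ _ _ _ fl).
  apply: (@riesz _ _ f (M * `|y|)) => x /=.
  by rewrite (le_trans (cauchy_schwarz _ _)) // mulrAC ler_wpM2r.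
have gb : g \in @bounded_linear R H.
  apply/asboolP; split.
    move=> c x y; apply: innerl_inj => z.
    by rewrite -gP !innerDr !innerZr !gP.
  exists M => x.
  have [->|gx0] := eqVneq (g x) 0.
    by rewrite normr0; exact: le_trans (normr_ge0 (A x)) (AM x).
  have gx : 0 < `|g x| by rewrite normr_gt0.
  rewrite -(ler_pM2r gx) -expr2 normr_inner -gP.
  have -> : '[A (g x), x] = `|'[A (g x), x]|.
    by rewrite gP -normr_inner ger0_norm ?exprn_ge0.
  rewrite (le_trans (cauchy_schwarz _ _)) // mulrAC ler_wpM2r //.
by exists (BoundedOp gb).
Qed.

(* A^*; it exists and is unique by adjoint_ex and adjoint_unique. *)
Definition adjoint A : 'B(H) := projT1 (cid (adjoint_ex A)).

Lemma adjointP A x y : '[A x, y] = '[x, adjoint A y].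
Proof. exact: (projT2 (cid (adjoint_ex A))). Qed.

Lemma adjoint_unique A B : (forall x y, '[A x, y] = '[x, B y]) -> B = adjoint A.
Proof.
move=> AB; apply: bopP => y; apply: innerl_inj => x.
by rewrite -AB adjointP.
Qed.

Lemma adjointK : involutive adjoint.
Proof.
move=> A; apply/esym/adjoint_unique => x y.
by rewrite innerC -adjointP -innerC.
Qed.

Lemma adjointD : {morph adjoint : A B / A + B}.
Proof.
move=> A B; apply/esym/adjoint_unique => x y.
by rewrite innerDl innerDr !adjointP.
Qed.

Lemma adjointM A B : adjoint (A * B) = adjoint B * adjoint A.
Proof.
apply/esym/adjoint_unique => x y.
exact: etrans (adjointP A (B x) y) (adjointP B x _).
Qed.

End Adjoint.

HB.mixin Record PzRing_hasStar T of GRing.PzRing T := {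
  star : T -> T;
  starK : involutive star;
  starD : {morph star : a b / a + b};
  starM : forall a b, star (a * b) = star b * star a
}.

#[short(type="starRingType")]
HB.structure Definition StarRing := {T of GRing.PzRing T & PzRing_hasStar T}.

HB.instance Definition _ (R : realType) (H : hilbertType R) :=
  PzRing_hasStar.Build 'B(H) (@adjointK R H) (@adjointD R H) (@adjointM R H).

Section JordanPolynomials.
Variable T : starRingType.

Definition diamond (a b : T) : T := a * b + b * star a.

(* p_n (x_1, ..., x_n), on the sequence of its arguments; the value at the
   empty sequence is irrelevant. *)
Definition jordan_poly (s : seq T) : T :=
  if s is a :: s' then foldl diamond a s' else 0.

Lemma jordan_poly1 a : jordan_poly [:: a] = a.
Proof. by []. Qed.

Lemma jordan_poly_rcons s a :
  s != [::] -> jordan_poly (rcons s a) = diamond (jordan_poly s) a.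
Proof. by case: s => //= b s _; rewrite foldl_rcons. Qed.

End JordanPolynomials.

Section VonNeumannAlgebras.
Variables (R : realType) (H : hilbertType R).

Definition matrix_coef (A : 'B(H)) : {ptws H * H -> R[i]^o} :=
  fun p => '[A p.1, p.2].

(* B(H) with the weak operator topology. *)
Definition wot : topologicalType := initial_topology matrix_coef.

Record vonNeumannAlgebra := VonNeumannAlgebra {
  vna_pred : {pred 'B(H)};
  vna_subring : subring_closed vna_pred;
  vna_scale : forall (c : R[i]) A, A \in vna_pred -> c *: A \in vna_pred;
  vna_adjoint : forall A, A \in vna_pred -> adjoint A \in vna_pred;
  vna_closed : closed ([set A | A \in vna_pred] : set wot)
}.

HB.instance Definition _ (M : vonNeumannAlgebra) :=
  GRing.isSubringClosed.Build 'B(H) (vna_pred M) (vna_subring M).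

Section Elements.
Variable M : vonNeumannAlgebra.

Record vna_elt := VnaElt {
  vna_val :> 'B(H);
  vna_valP : vna_val \in vna_pred M
}.

HB.instance Definition _ := [isSub for vna_val].
HB.instance Definition _ := [Choice of vna_elt by <:].
HB.instance Definition _ :=
  GRing.SubChoice_isSubPzRing.Build _ _ vna_elt (subringClosedP _).

Definition vna_star (a : vna_elt) : vna_elt :=
  VnaElt (vna_adjoint (vna_valP a)).

Lemma vna_starK : involutive vna_star.
Proof. by move=> a; apply/val_inj; exact: adjointK. Qed.

Lemma vna_starD : {morph vna_star : a b / a + b}.
Proof. by move=> a b; apply/val_inj; exact: adjointD. Qed.

Lemma vna_starM a b : vna_star (a * b) = vna_star b * vna_star a.
Proof. by apply/val_inj; exact: adjointM. Qed.

HB.instance Definition _ :=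
  PzRing_hasStar.Build vna_elt vna_starK vna_starD vna_starM.

End Elements.

End VonNeumannAlgebras.

Coercion vna_elt : vonNeumannAlgebra >-> Sortclass.

Section TypeI1.
Variables (R : realType) (H : hilbertType R) (M : vonNeumannAlgebra H).
Implicit Types a b p : M.

Definition projection p := p * p = p /\ star p = p.

Definition central_projection p :=
  projection p /\ forall a, p * a = a * p.

Definition abelian_projection p :=
  projection p /\
  forall a b, (p * a * p) * (p * b * p) = (p * b * p) * (p * a * p).

(* The central summand M p is of type I_n when its unit p is the sum of n
   equivalent abelian projections; for n = 1, when p itself is abelian. *)
Definition typeI1_central_summand p :=
  [/\ p != 0, central_projection p & abelian_projection p].

End TypeI1.

Definition without_typeI1_central_summands (R : realType) (H : hilbertType R)
    (M : vonNeumannAlgebra H) :=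
  ~ exists p : M, typeI1_central_summand p.

Definition additive_star_derivation (R : realType) (H : hilbertType R)
    (M : vonNeumannAlgebra H) (delta : M -> 'B(H)) :=
  [/\ forall a b : M, delta (a + b) = delta a + delta b,
      forall a b : M, delta (a * b) = delta a * vna_val b + vna_val a * delta b
    & forall a : M, delta (star a) = star (delta a)].

(* Main.v *)
Require Import Defs.
From HB Require Import structures.
From mathcomp Require Import all_boot all_order all_algebra.
From mathcomp Require Import all_classical all_reals.
From mathcomp Require Import topology normedtype.
From mathcomp Require Import complex lra.
From Stdlib Require Ncring Ncring_tac.
Set Implicit Arguments.
Unset Strict Implicit.
Unset Printing Implicit Defensive.
Import Order.TTheory GRing.Theory Num.Theory numFieldNormedType.Exports.
Local Open Scope classical_set_scope.
Local Open Scope complex_scope.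
Local Open Scope ring_scope.

(** That additive star-derivations satisfy the identity is an induction on the
    length of the polynomial, since the diamond product is biadditive
    ([leibniz_sum_derivation]).  The converse has an algebraic half, valid in
    star rings, and an analytic half, which feeds it one fact about [A].

    Reduction to two variables ([jordan_diamond]).  The scalar 1/2 is a left
    unit of the diamond product.  Putting 1/2 in all places but the last shows
    that [delta (1/2)] is skew-adjoint and commutes with [A], so that its
    diamond product with every element of [A] vanishes; putting 1/2 in all
    places but the last two then gives the identity for n = 2.

    Additivity ([delta_add]).  The defect
    [delta (a + b) - delta a - delta b] is compatible with diamond products on
    both sides, so a product that kills [a] or [b] annihilates the defect.
    Multiplying by suitable combinations of a projection p and 1 - p shows that
    [delta] respects the Peirce decomposition of p and is additive on the
    corners p A (1 - p).  Hence the defect of arbitrary a, b annihilates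
    p A (1 - p) and (1 - p) A p, and therefore every commutator [p y - y p].

    The derivation property ([delta_mul]).  Once additive, [delta] fails to
    preserve the star by a multiple of [delta 1] and fails to be a derivation
    by a multiple of [delta i], both of which commute with [A].  Comparing
    [diamond a b] with [diamond b a] for selfadjoint a, b, and the two ways of
    expanding [delta (x y z)], shows that these multipliers also annihilate the
    commutators [p y - y p].

    The analytic fact ([commutators_faithful]) is that an operator [T] with
    [T (p y - y p) = 0] for all projections p and all y in [A] is zero.  Let
    [F] be the projection onto the common kernel of these commutators.  It lies
    in [A] and it is central.  On its range every element of [A] commutes with
    all projections of [A]; since each selfadjoint contraction has a dyadic
    expansion with coefficients [2 E - 1], [E] a projection ([vna_sign]), all of
    [A] is commutative there.  So [F] would be a central summand of type I_1,
    and [F = 0]; the range of the adjoint of [T] lies in that of [F], whence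
    [T = 0].  The projections come from weak limits along ultrafilters of
    bounded sets of operators ([weak_limit], [vna_kernel_projection]), and the
    absolute values that [vna_sign] needs from a norm-convergent iteration
    ([vna_sqrt]). *)

(** * Star rings and the diamond product *)

(** Structure of noncommutative ring for the tactic that decides identities
    between noncommutative polynomials. *)

#[local] Instance pz_ops (T : pzRingType) :
  @Ncring.Ring_ops T 0 1 +%R *%R (fun x y => x - y) -%R eq := {}.
#[local] Instance pz_ring (T : pzRingType) :
  @Ncring.Ring T 0 1 +%R *%R (fun x y => x - y) -%R eq (pz_ops T).
Proof.
split; try exact _; move=> *.
- exact: add0r. - exact: addrC. - exact: addrA. - exact: mul1r. - exact: mulr1.
- exact: mulrA. - exact: mulrDl. - exact: mulrDr. - by []. - exact: subrr.
Qed.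
Ltac ncring := Ncring_tac.non_commutative_ring.

Section StarRings.
Variable T : starRingType.
Implicit Types a b c x : T.

Lemma star0 : star (0 : T) = 0.
Proof. by apply: (addrI (star 0)); rewrite -starD !addr0. Qed.

Lemma starN a : star (- a) = - star a.
Proof. by apply: (addrI (star a)); rewrite -starD !subrr star0. Qed.

Lemma starB a b : star (a - b) = star a - star b.
Proof. by rewrite starD starN. Qed.

Lemma star1 : star (1 : T) = 1.
Proof. by rewrite -[LHS]mul1r -{1}(starK 1) -starM mul1r starK. Qed.

Lemma diamondDl a b c : diamond (a + b) c = diamond a c + diamond b c.
Proof. by rewrite /diamond starD; ncring. Qed.

Lemma diamondDr a b c : diamond a (b + c) = diamond a b + diamond a c.
Proof. by rewrite /diamond; ncring. Qed.

Lemma diamondNl a b : diamond (- a) b = - diamond a b.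
Proof. by rewrite /diamond starN; ncring. Qed.

Lemma diamondNr a b : diamond a (- b) = - diamond a b.
Proof. by rewrite /diamond; ncring. Qed.

Lemma diamond0l a : diamond 0 a = 0.
Proof. by rewrite /diamond star0; ncring. Qed.

Lemma diamond0r a : diamond a 0 = 0.
Proof. by rewrite /diamond; ncring. Qed.

Lemma diamond_sum I (r : seq I) (F : I -> T) a :
  diamond (\sum_(i <- r) F i) a = \sum_(i <- r) diamond (F i) a.
Proof.
elim: r => [|i r IH]; first by rewrite !big_nil diamond0l.
by rewrite !big_cons diamondDl IH.
Qed.

End StarRings.

(** * Maps that satisfy the two-variable identity: additivity *)

Section JordanDerivable.
Variables (M B : starRingType) (v : {rmorphism M -> B}).
Hypotheses (v_inj : injective v) (v_star : forall a, v (star a) = star (v a)).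
Variables (im half : M).
Hypotheses (im_star : star im = - im) (im_sqr : im * im = - 1).
Hypothesis im_central : forall x : B, v im * x = x * v im.
Hypothesis halfD : half + half = 1.
Hypothesis double_inj : forall x : B, x + x = 0 -> x = 0.

Definition star_projection (p : M) := p * p = p /\ star p = p.

(** For a von Neumann algebra this is where the absence of central summands of
    type I_1 enters. *)
Hypothesis commutators_faithful : forall x : B,
  (forall p y : M, star_projection p -> x * v (p * y - y * p) = 0) -> x = 0.

Variable delta : M -> B.
Hypothesis delta_diamond : forall a b,
  delta (diamond a b) = diamond (delta a) (v b) + diamond (v a) (delta b).

Let vE := (rmorphM v, rmorphD v, rmorphB v, rmorphN v, rmorph1 v, rmorph0 v,
  v_star).

Lemma im_centralM (a : M) : im * a = a * im.
Proof. by apply: v_inj; rewrite !rmorphM im_central. Qed.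

Lemma double_injM (a : M) : a + a = 0 -> a = 0.
Proof.
move=> /(congr1 v); rewrite !vE => /double_inj h.
by apply: v_inj; rewrite h !vE.
Qed.

Lemma half_double (a : M) : half * (a + a) = a.
Proof. by rewrite mulrDr -mulrDl halfD mul1r. Qed.

Lemma half_star : star half = half.
Proof.
apply/subr0_eq/double_injM.
have : star (half + half) = half + half by rewrite halfD star1.
by rewrite starD => h; rewrite addrACA h -opprD subrr.
Qed.

Lemma half_central (a : M) : half * a = a * half.
Proof.
apply/subr0_eq/double_injM.
have -> : half * a - a * half + (half * a - a * half)
   = (half + half) * a - a * (half + half) by ncring.
by rewrite halfD; ncring.
Qed.

Lemma cartesian_decomposition (y : M) :
  exists a b, [/\ star a = a, star b = b & y = a + im * b].
Proof.
exists (half * (y + star y)), (half * (im * (star y - y))); split.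
- by rewrite starM starD starK half_star half_central addrC.
- rewrite !starM starB starK half_star im_star -half_central; congr (_ * _).
  by rewrite mulrN -im_centralM; ncring.
- rewrite mulrA im_centralM -mulrA -mulrDr mulrA im_sqr.
  have -> : y + star y + -1 * (star y - y) = y + y by ncring.
  by rewrite half_double.
Qed.

Lemma delta0 : delta 0 = 0.
Proof.
by have := delta_diamond 0 0; rewrite diamond0r !vE diamond0r diamond0l addr0.
Qed.

(** The identity makes the defect compatible with diamond products on either
    side.  When the product kills one of the two arguments, the right-hand
    sides of [diamond_defect] and [defect_diamond] vanish: this is how all
    additivity statements below are obtained. *)
Definition defect a b := delta (a + b) - delta a - delta b.

Lemma defect_eq0 a b : defect a b = 0 -> delta (a + b) = delta a + delta b.
Proof. by move=> h; apply/subr0_eq; rewrite opprD addrA. Qed.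

Lemma defect0r a : defect a 0 = 0.
Proof. by rewrite /defect delta0 addr0 subrr subr0. Qed.

Lemma defect0l a : defect 0 a = 0.
Proof. by rewrite /defect delta0 add0r subr0 subrr. Qed.

Lemma diamond_defect x a b :
  diamond (v x) (defect a b) = defect (diamond x a) (diamond x b).
Proof.
rewrite /defect -diamondDr !delta_diamond.
rewrite !(diamondDr, diamondNr) !vE !(diamondDr, diamondNr); ncring.
Qed.

Lemma defect_diamond x a b :
  diamond (defect a b) (v x) = defect (diamond a x) (diamond b x).
Proof.
rewrite /defect -diamondDl !delta_diamond.
rewrite !(diamondDl, diamondNl) !vE !(diamondDl, diamondNl); ncring.
Qed.

Lemma delta_diamond_split x x' y y' :
  delta (x + x') = delta x + delta x' -> delta (y + y') = delta y + delta y' ->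
  delta (diamond (x + x') (y + y')) =
  delta (diamond x y) + delta (diamond x y') +
  (delta (diamond x' y) + delta (diamond x' y')).
Proof.
move=> ex ey; rewrite !delta_diamond ex ey !rmorphD.
by rewrite !(diamondDl, diamondDr); ncring.
Qed.

Lemma mul_im_eq0 (x : B) : v im * x = 0 -> x = 0.
Proof.
move=> h; have : v (- im) * (v im * x) = 0 by rewrite h mulr0.
by rewrite mulrA -rmorphM mulNr im_sqr opprK rmorph1 mul1r.
Qed.

Lemma diamond_im a (x : B) :
  diamond (v (im * a)) x = v im * (v a * x - x * v (star a)).
Proof.
have e : x * (star (v a) * v im) = v im * (x * star (v a)).
  by rewrite mulrA im_central.
by rewrite /diamond -v_star starM im_star mulrN !vE mulrN e; ncring.
Qed.

Section Peirce.
Variable p : M.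
Hypothesis pP : star_projection p.
Local Notation q := (1 - p).

Let pp : p * p = p := pP.1.
Let ps : star p = p := pP.2.
Let qp : q * p = 0. Proof. by rewrite mulrBl mul1r pp subrr. Qed.
Let qq : q * q = q. Proof. by rewrite mulrBr mulr1 qp subr0. Qed.
Let qs : star q = q. Proof. by rewrite starB star1 ps. Qed.

Lemma projection_compl : star_projection q. Proof. by []. Qed.

Let ppx (x : M) : p * (p * x) = p * x. Proof. by rewrite mulrA pp. Qed.
Let vpp : v p * v p = v p. Proof. by rewrite -rmorphM pp. Qed.
Let vppx x : v p * (v p * x) = v p * x. Proof. by rewrite mulrA vpp. Qed.
Let vps : star (v p) = v p. Proof. by rewrite -v_star ps. Qed.

Ltac peirce :=
  rewrite ?vE ?(starM, starD, starB, starN, star1, starK, ps, vps, vE);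
  rewrite ?(mulrDl, mulrDr, mulrBl, mulrBr, mulNr, mulrN, mul1r, mulr1);
  rewrite -?mulrA ?(ppx, pp, vppx, vpp); ncring.

(** The first equation says that x anticommutes with the reflection 2 p - 1, and
    the second that it commutes with it. *)
Lemma reflection_faithful (x : B) :
  diamond (v (p - q)) x = 0 -> diamond (v (im * (p - q))) x = 0 -> x = 0.
Proof.
rewrite /diamond => h1 h2; set j := p - q in h1 h2.
have js : star j = j by rewrite /j; peirce.
have jj : j * j = 1 by rewrite /j; peirce.
have h3 : v j * x - x * v j = 0.
  by apply: mul_im_eq0; rewrite -{2}js -diamond_im.
have {}h1 : v j * x + x * v j = 0 by rewrite -{2}js v_star.
have h4 : v j * x = 0.
  apply: double_inj.
  have -> : v j * x + v j * x = (v j * x + x * v j) + (v j * x - x * v j).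
    by ncring.
  by rewrite h1 h3 addr0.
by rewrite -(mul1r x) -(rmorph1 v) -jj vE -mulrA h4 mulr0.
Qed.

(** The reflection kills both corners, and multiplication by p or q on the right
    kills one of them; the last two facts make the defect skew-adjoint and
    commuting with p. *)
Lemma delta_add_offdiagonal b c :
  delta (p * b * q + q * c * p) = delta (p * b * q) + delta (q * c * p).
Proof.
apply: defect_eq0; set x := defect _ _.
have jx : diamond (v (p - q)) x = 0.
  rewrite diamond_defect (_ : diamond _ _ = 0) ?defect0l //.
  by rewrite /diamond; peirce.
have xp : diamond x (v p) = 0.
  rewrite defect_diamond (_ : diamond _ _ = 0) ?defect0l //.
  by rewrite /diamond; peirce.
have xq : diamond x (v q) = 0.
  rewrite defect_diamond (_ : diamond (q * c * p) _ = 0) ?defect0r //.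
  by rewrite /diamond; peirce.
apply: reflection_faithful => //.
have xs : star x = - x.
  apply/eqP; rewrite -addr_eq0; apply/eqP; have := congr2 +%R xp xq.
  by rewrite addr0 -diamondDr -rmorphD addrC subrK /diamond vE mulr1 mul1r addrC.
have {}xp : x * v p - v p * x = 0 by rewrite -xp /diamond xs; ncring.
rewrite diamond_im (_ : v (p - q) * x - _ = 0) ?mulr0 //.
have -> : star (p - q) = p - q by peirce.
have -> : v (p - q) * x - x * v (p - q) =
    - (x * v p - v p * x) - (x * v p - v p * x) by rewrite !vE; ncring.
by rewrite xp oppr0 addr0.
Qed.

Lemma delta_add_diagonal a d :
  delta (p * a * p + q * d * q) = delta (p * a * p) + delta (q * d * q).
Proof.
apply: defect_eq0; set x := defect _ _.
have xp : diamond (v p) x = 0.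
  rewrite diamond_defect (_ : diamond p (q * d * q) = 0) ?defect0r //.
  by rewrite /diamond; peirce.
have xq : diamond (v q) x = 0.
  rewrite diamond_defect (_ : diamond q (p * a * p) = 0) ?defect0l //.
  by rewrite /diamond; peirce.
apply: double_inj; have := congr2 +%R xp xq.
by rewrite addr0 -diamondDl -rmorphD addrC subrK /diamond vE star1 mulr1 mul1r.
Qed.

(** The reflection kills the off-diagonal part, and i times the reflection the
    diagonal part. *)
Lemma delta_add_diagonal_offdiagonal a b c d :
  delta (p * a * p + q * d * q + (p * b * q + q * c * p)) =
  delta (p * a * p + q * d * q) + delta (p * b * q + q * c * p).
Proof.
apply: defect_eq0; apply: reflection_faithful.
  rewrite diamond_defect (_ : diamond _ (p * b * q + q * c * p) = 0) ?defect0r //.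
  by rewrite /diamond; peirce.
rewrite diamond_defect (_ : diamond _ (p * a * p + q * d * q) = 0) ?defect0l //.
apply: v_inj; rewrite -/(diamond _ _) {1}/diamond.
have := diamond_im (p - q) (v (p * a * p + q * d * q)).
rewrite /diamond -v_star -!rmorphM -rmorphD => ->.
by rewrite !vE (_ : _ - _ = 0) ?mulr0 //; peirce.
Qed.

Lemma peirce_sum a : a = p * a * p + q * a * q + (p * a * q + q * a * p).
Proof. by peirce. Qed.

Lemma delta_peirce a : delta a =
  delta (p * a * p) + delta (q * a * q) + (delta (p * a * q) + delta (q * a * p)).
Proof.
rewrite {1}(peirce_sum a) delta_add_diagonal_offdiagonal.
by rewrite delta_add_diagonal delta_add_offdiagonal.
Qed.

Lemma defect_peirce a b : defect a b =
  defect (p * a * p) (p * b * p) + defect (q * a * q) (q * b * q) +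
  (defect (p * a * q) (p * b * q) + defect (q * a * p) (q * b * p)).
Proof.
by rewrite /defect !(delta_peirce (a + b)) (delta_peirce a) (delta_peirce b)
  -!mulrDl -!mulrDr; ncring.
Qed.

(** The corners p b q and p c q both occur in the diamond product of p + p b q
    and q + p c q, whose remaining terms lie in other Peirce components; and
    [delta] is already known to be additive on each of the two factors. *)
Lemma defect_corner b c : defect (p * b * q) (p * c * q) = 0.
Proof.
have dp : delta (p + p * b * q) = delta p + delta (p * b * q).
  have := delta_add_diagonal_offdiagonal p b 0 0.
  by rewrite !(mulr0, mul0r, addr0) !pp.
have dq : delta (q + p * c * q) = delta q + delta (p * c * q).
  have := delta_add_diagonal_offdiagonal 0 c 0 q.
  by rewrite !(mulr0, mul0r, addr0, add0r) !qq.
have h := delta_diamond_split dp dq.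
have epq : diamond p q = 0 by rewrite /diamond; peirce.
have epc : diamond p (p * c * q) = p * c * q by rewrite /diamond; peirce.
have ebq : diamond (p * b * q) q = p * b * q + q * star b * p.
  by rewrite /diamond; peirce.
have ebc : diamond (p * b * q) (p * c * q) = p * (c * q * star b) * p.
  by rewrite /diamond; peirce.
rewrite epq epc ebq ebc delta_add_offdiagonal delta0 in h.
have e : diamond (p + p * b * q) (q + p * c * q)
  = p * (c * q * star b) * p + q * 0 * q + (p * (b + c) * q + q * star b * p).
  by rewrite /diamond; peirce.
rewrite e delta_add_diagonal_offdiagonal delta_add_diagonal in h.
rewrite delta_add_offdiagonal mulr0 mul0r delta0 addr0 add0r in h.
rewrite /defect -mulrDl -mulrDr.
have -> : delta (p * (b + c) * q) = delta (p * (c * q * star b) * p) +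
  (delta (p * (b + c) * q) + delta (q * star b * p)) -
  delta (p * (c * q * star b) * p) - delta (q * star b * p) by ncring.
by rewrite h; ncring.
Qed.

(** Left multiplication by q kills the corner p A p. *)
Lemma defect_diagonal_local a b :
  defect (p * a * p) (p * b * p) * v q = 0.
Proof.
set x := defect _ _.
have qx : diamond (v q) x = 0.
  rewrite diamond_defect (_ : diamond _ _ = 0) ?defect0l //.
  by rewrite /diamond; peirce.
rewrite /diamond -v_star qs in qx.
have vqq : v q * v q = v q by rewrite -rmorphM qq.
apply: double_inj.
have -> : x * v q + x * v q = (v q * x + x * v q) * v q + (v q * x + x * v q)
  - v q * (v q * x + x * v q) + x * (v q - v q * v q)
  - (v q - v q * v q) * x by ncring.
by rewrite qx vqq subrr !(mulr0, mul0r, addr0, subr0).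
Qed.

(** Multiplying p A p by p y q on the right lands in the corner p A q, where
    [delta] is additive. *)
Lemma defect_diagonal_faithful a b y :
  defect (p * a * p) (p * b * p) * v (p * y * q) = 0.
Proof.
have := defect_diagonal_local a b; set x := defect _ _ => xq.
have xy : diamond x (v (p * y * q)) = 0.
  rewrite defect_diamond.
  have e c : diamond (p * c * p) (p * y * q) = p * (c * p * y) * q.
    by rewrite /diamond; peirce.
  by rewrite !e defect_corner.
have qxs : v q * star x = 0.
  by rewrite -(starK (v q)) -starM -v_star qs xq star0.
move: xy; rewrite /diamond.
have -> : v (p * y * q) * star x = 0 by rewrite rmorphM -mulrA qxs mulr0.
by rewrite addr0.
Qed.

End Peirce.

(** Of the four Peirce components of the defect, the two corners vanish; the one
    at e annihilates the corner e M (1 - e), and the one at 1 - e annihilates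
    e. *)
Lemma delta_add a b : delta (a + b) = delta a + delta b.
Proof.
apply/defect_eq0/commutators_faithful => p y pP.
have key e : star_projection e -> defect a b * v (e * y * (1 - e)) = 0.
  move=> eP; have eP' := projection_compl eP.
  have ee : 1 - (1 - e) = e by rewrite opprB addrC subrK.
  rewrite (defect_peirce eP) (defect_corner eP).
  have := defect_corner eP' a b; rewrite ee => ->.
  rewrite !addr0 mulrDl (defect_diagonal_faithful eP) add0r.
  have := defect_diagonal_local eP' a b; rewrite ee => h.
  by rewrite !rmorphM !mulrA h !mul0r.
have -> : p * y - y * p = p * y * (1 - p) - (1 - p) * y * (1 - (1 - p)).
  by ncring.
by rewrite rmorphB mulrBr (key _ pP) (key _ (projection_compl pP)) subrr.
Qed.

(** * Maps that satisfy the two-variable identity: the derivation property *)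

Lemma deltaN a : delta (- a) = - delta a.
Proof. by apply: (addrI (delta a)); rewrite -delta_add !subrr delta0. Qed.

Lemma diamond1l (T : starRingType) (x : T) : diamond 1 x = x + x.
Proof. by rewrite /diamond star1 mul1r mulr1. Qed.

Lemma diamond1r (T : starRingType) (x : T) : diamond x 1 = x + star x.
Proof. by rewrite /diamond mul1r mulr1. Qed.

(** The case a = 1 gives skew-adjointness; the identity then becomes a
    commutation relation. *)
Lemma skew_central (x : B) : (forall a, diamond x (v a) = 0) ->
  star x = - x /\ forall a, x * v a = v a * x.
Proof.
move=> h; have xs : star x = - x.
  by apply/eqP; rewrite -addr_eq0 addrC; have := h 1; rewrite rmorph1 diamond1r
    => ->.
split=> // a; apply/subr0_eq; rewrite -[RHS](h a) /diamond xs; ncring.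
Qed.

Lemma delta1_skew_central :
  star (delta 1) = - delta 1 /\ forall a, delta 1 * v a = v a * delta 1.
Proof.
apply: skew_central => a; have := delta_diamond 1 a.
rewrite !diamond1l rmorph1 diamond1l delta_add => h.
by apply: (addIr (delta a + delta a)); rewrite add0r -h.
Qed.

Lemma delta_im_skew_central :
  star (delta im) = - delta im /\ forall a, delta im * v a = v a * delta im.
Proof.
apply: skew_central => a; have := delta_diamond im a.
have e x : diamond (v im) x = 0.
  rewrite -(mulr1 im) diamond_im.
  by rewrite star1 !rmorph1 mul1r mulr1 subrr mulr0.
by rewrite e (_ : diamond im a = 0) ?delta0 ?addr0 //; apply: v_inj;
  rewrite /diamond !vE; have := e (v a); rewrite /diamond.
Qed.

Lemma delta_star_defect a :
  delta (star a) = star (delta a) + delta 1 * v (a + star a).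
Proof.
have [ds dC] := delta1_skew_central.
have := delta_diamond a 1; rewrite !(diamond1r, rmorph1) delta_add.
rewrite /(diamond (v a) _) -v_star -!dC -addrA => /addrI ->.
by rewrite -mulrDr rmorphD.
Qed.

Lemma annihilates_commutators (x : B) :
  (forall p b : M, star_projection p -> star b = b -> x * v (p * b - b * p) = 0) ->
  x = 0.
Proof.
move=> h; apply: commutators_faithful => p y pP.
have [a [b [sa sb ->]]] := cartesian_decomposition y.
have -> : p * (a + im * b) - (a + im * b) * p =
    (p * a - a * p) + ((im * p) * b - im * (b * p)).
  by rewrite (im_centralM p); ncring.
rewrite rmorphD mulrDr h // add0r -mulrA -mulrBr rmorphM mulrA -im_central.
by rewrite -mulrA h // mulr0.
Qed.

(** For selfadjoint a and b, [diamond a b = diamond b a], while the two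
    expansions of its image differ by [2 delta 1 (a b - b a)]. *)
Lemma delta1_eq0 : delta 1 = 0.
Proof.
have [_ dC] := delta1_skew_central.
apply: annihilates_commutators => a b [_ sa] sb; apply: double_inj.
have e c : star c = c -> star (delta c) = delta c - (delta 1 * v c + delta 1 * v c).
  move=> sc; have := delta_star_defect c; rewrite sc => {2}->.
  by rewrite rmorphD; ncring.
have := delta_diamond a b; rewrite (_ : diamond a b = diamond b a); last first.
  by rewrite /diamond sa sb addrC.
rewrite delta_diamond /diamond -!v_star sa sb !e //.
set x := delta a; set y := delta b; rewrite !vE.
set d := delta 1; move: (dC a) (dC b); rewrite -/d => da db h.
have -> : d * (v a * v b - v b * v a) + d * (v a * v b - v b * v a) =
  (x * v b + v b * (x - (d * v a + d * v a)) + (v a * y + y * v a)) -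
  (y * v a + v a * (y - (d * v b + d * v b)) + (v b * x + x * v b)) +
  (d * v a - v a * d + (d * v a - v a * d)) * v b -
  (d * v b - v b * d + (d * v b - v b * d)) * v a by ncring.
by rewrite h da db !subrr !(addr0, mul0r, subr0).
Qed.

Lemma delta_star a : delta (star a) = star (delta a).
Proof. by rewrite delta_star_defect delta1_eq0 mul0r addr0. Qed.

(** By [diamond b im = 2 im b] for selfadjoint b, and then by the Cartesian
    decomposition. *)
Lemma delta_im_mul a : delta (im * a) = v im * delta a + delta im * v (star a).
Proof.
have [_ tC] := delta_im_skew_central.
have ims : star (v im) = - v im by rewrite -v_star im_star rmorphN.
have key b : star b = b -> delta (im * b) = v im * delta b + delta im * v b.
  move=> sb; apply/subr0_eq/double_inj.
  have := delta_diamond b im; have -> : diamond b im = im * b + im * b.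
    by rewrite /diamond sb im_centralM.
  rewrite delta_add /diamond -delta_star -v_star sb => h.
  rewrite opprD addrACA -opprD h -!im_central -tC; ncring.
have [b [c [sb sc ->]]] := cartesian_decomposition a.
rewrite starD starM sb sc im_star mulrN -im_centralM.
rewrite mulrDr mulrA im_sqr mulN1r !delta_add deltaN !key // !vE.
have imv : v im * v im = -1 by rewrite -rmorphM im_sqr rmorphN rmorph1.
rewrite !mulrDr mulrA imv mulrN (mulrA _ (v im)) -(im_central (delta im)).
ncring.
Qed.

(** The obstruction to the Leibniz rule: its product with [delta im] measures the
    failure of [delta] to be a derivation, so that [delta im] annihilates its
    Hochschild coboundary. *)
Definition cocycle y z : M :=
  star y * z - z * y - star z * star y + y * star z.

(** The identity at y, z determines [delta (y z + z (star y))] and the identity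
    at [im y], z determines [delta (y z - z (star y))], up to [delta im]. *)
Lemma delta_mul_defect y z :
  v im * (delta (y * z) + delta (y * z)) =
  v im * (delta y * v z + v y * delta z + (delta y * v z + v y * delta z)) +
  delta im * v (cocycle y z).
Proof.
have [ts tC] := delta_im_skew_central.
have e1 := delta_diamond y z; have e2 := delta_diamond (im * y) z.
rewrite [diamond y z]/diamond delta_add in e1.
have e3 : diamond (im * y) z = im * (y * z - z * star y).
  by rewrite /diamond starM im_star mulrN mulrN mulrA -im_centralM; ncring.
rewrite e3 !delta_im_mul diamond_im delta_add deltaN in e2.
have ims : star (v im) = - v im by rewrite -v_star im_star rmorphN.
move: e1 e2; rewrite /diamond /cocycle.
rewrite !(vE, starD, starN, starM, starK, ims, ts).
have := tC y; have := tC (star y); rewrite v_star.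
have := tC z; have := im_central (star (delta y)); have := im_central (v z).
set X := delta y; set X' := star X; set Z := delta z.
set i := v im; set t := delta im; set y1 := v y; set y2 := star y1.
set z1 := v z; set z2 := star z1.
move=> iz iX tz ty2 ty e1 e2; apply/subr0_eq.
set L := (X in X = 0).
have -> : L = i * (delta (y * z) + delta (z * star y) -
     (X * z1 + z1 * X' + (y1 * Z + Z * y2))) +
   (i * (delta (y * z) - delta (z * star y)) + t * (z2 * y2 - y1 * z2)
    - ((i * X + t * y2) * z1 + z1 * (X' * - i + y1 * - t) + i * (y1 * Z - Z * y2)))
   + (i * z1 - z1 * i) * X' + z1 * (i * X' - X' * i)
   + (t * z1 - z1 * t) * y1 + z1 * (t * y1 - y1 * t).
  by rewrite /L; ncring.
by rewrite e1 e2 iz iX tz ty !subrr !(mulr0, mul0r, addr0).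
Qed.

(** The coboundary of [cocycle] at (p, p, b) is multiplied to zero by [delta im];
    for a projection p and selfadjoint b it equals
    2 p b p - p b - b p, whose commutator with p is p b - b p up to sign. *)
Lemma delta_im_eq0 : delta im = 0.
Proof.
have [_ tC] := delta_im_skew_central; set t := delta im in tC *.
(* Associativity: expand 2 i delta (x y z) in two ways. *)
have tcocycle x y z : t * v (cocycle x y * z + cocycle (x * y) z
    - x * cocycle y z - cocycle x (y * z)) = 0.
  have h1 := delta_mul_defect (x * y) z; have h2 := delta_mul_defect x (y * z).
  have h3 := delta_mul_defect x y; have h4 := delta_mul_defect y z.
  move: h1 h2 h3 h4 (im_central (v x)) (tC x); rewrite -mulrA -/t.
  move: (cocycle x y) (cocycle (x * y) z) (cocycle y z) (cocycle x (y * z)).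
  move=> k1 k2 k3 k4 ->.
  rewrite -/t !rmorphB rmorphD !rmorphM.
  set X := delta x; set Y := delta y; set Z := delta z; set i := v im.
  set XY := delta (x * y); set YZ := delta (y * z).
  set x1 := v x; set y1 := v y; set z1 := v z.
  set c1 := v k1; set c2 := v k2; set c3 := v k3; set c4 := v k4.
  move=> h h3 h4 ix tx; apply/subr0_eq; rewrite subr0.
  set L := (X in X = 0).
  pose h3' := i * (XY + XY) - (i * (X * y1 + x1 * Y + (X * y1 + x1 * Y)) + t * c1).
  pose h4' := i * (YZ + YZ) - (i * (Y * z1 + y1 * Z + (Y * z1 + y1 * Z)) + t * c3).
  have -> : L = - h3' * z1 + x1 * h4' +
    (i * (XY * z1 + x1 * y1 * Z + (XY * z1 + x1 * y1 * Z)) + t * c2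
    - (i * (X * (y1 * z1) + x1 * YZ + (X * (y1 * z1) + x1 * YZ)) + t * c4))
   + (i * x1 - x1 * i) * (YZ + YZ - (Y * z1 + y1 * Z + (Y * z1 + y1 * Z)))
   - (t * x1 - x1 * t) * c3.
    by rewrite /L /h3' /h4'; ncring.
  by rewrite /h3' /h4' h3 h4 h ix tx !subrr !(mulr0, mul0r, addr0, oppr0).
apply: annihilates_commutators => p b [pp ps] sb.
have ppx x : p * (p * x) = p * x by rewrite mulrA pp.
have := tcocycle p p b; set c := (X in v X) => tc.
have -> : p * b - b * p = c * p - p * c.
  rewrite /c /cocycle !(starM, ps, sb).
  rewrite ?(mulrDl, mulrDr, mulrBl, mulrBr, mulNr, mulrN) -?mulrA ?(ppx, pp).
  ncring.
clearbody c; rewrite rmorphB !rmorphM mulrBr !mulrA tc tC -mulrA tc.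
by rewrite mul0r mulr0 subrr.
Qed.

Lemma delta_mul y z : delta (y * z) = delta y * v z + v y * delta z.
Proof.
apply/subr0_eq/double_inj/mul_im_eq0.
have := delta_mul_defect y z; rewrite delta_im_eq0 mul0r addr0 => h.
rewrite -(subrr (v im * (delta (y * z) + delta (y * z)))) {2}h -mulrBr.
by congr (_ * _); ncring.
Qed.

Theorem diamond_derivable_star_derivation :
  [/\ forall a b, delta (a + b) = delta a + delta b,
      forall a b, delta (a * b) = delta a * v b + v a * delta b
    & forall a, delta (star a) = star (delta a)].
Proof. by split; [exact: delta_add|exact: delta_mul|exact: delta_star]. Qed.

End JordanDerivable.

(** * Reduction of the n-variable identity to two variables *)

Section PolynomialIdentity.
Variables (M B : starRingType) (v : {rmorphism M -> B}) (delta : M -> B).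
Hypothesis v_star : forall a, v (star a) = star (v a).

(** The right-hand side of the identity, on sequences, where it can be computed
    by adding arguments at the end. *)
Definition leibniz_sum (s : seq M) : B :=
  \sum_(k < size s) jordan_poly
    (mkseq (fun i => if i == k then delta (nth 0 s i) else v (nth 0 s i)) (size s)).

Lemma leibniz_sum1 a : leibniz_sum [:: a] = delta a.
Proof. by rewrite /leibniz_sum big_ord_recl big_ord0 addr0. Qed.

Lemma leibniz_sum_rcons s b : s != [::] ->
  leibniz_sum (rcons s b) =
  diamond (leibniz_sum s) (v b) + diamond (jordan_poly (map v s)) (delta b).
Proof.
move=> s0; rewrite /leibniz_sum size_rcons big_ord_recr diamond_sum.
have mk0 (f : nat -> B) : mkseq f (size s) != [::].
  by rewrite -size_eq0 size_mkseq size_eq0.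
congr (_ + _).
  apply: eq_bigr => k _; rewrite mkseqS jordan_poly_rcons //.
  rewrite nth_rcons ltnn eqxx /= gtn_eqF //.
  congr (diamond (jordan_poly _) _).
  apply/eq_in_map => i; rewrite mem_iota add0n => /= ilt.
  by rewrite nth_rcons ilt.
rewrite mkseqS jordan_poly_rcons //= nth_rcons ltnn eqxx.
congr (diamond (jordan_poly _) _).
rewrite -[RHS](mkseq_nth 0) size_map; apply/eq_in_map => i.
rewrite mem_iota add0n => /= ilt.
by rewrite nth_rcons ilt ltn_eqF // (nth_map 0).
Qed.

Lemma jordan_poly_map s : jordan_poly (map v s) = v (jordan_poly s).
Proof.
elim/last_ind: s => [|s a IH]; first by rewrite /= rmorph0.
have [->|s0] := eqVneq s [::]; first by [].
rewrite map_rcons !jordan_poly_rcons //; last by rewrite -size_eq0 size_map size_eq0.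
by rewrite IH /diamond rmorphD !rmorphM v_star.
Qed.

Lemma leibniz_sum_derivation :
  (forall a b, delta (diamond a b) =
     diamond (delta a) (v b) + diamond (v a) (delta b)) ->
  forall s, s != [::] -> delta (jordan_poly s) = leibniz_sum s.
Proof.
move=> hd; elim/last_ind => [//|s a IH] _.
have [->|s0] := eqVneq s [::]; first by rewrite /= leibniz_sum1.
by rewrite jordan_poly_rcons // hd leibniz_sum_rcons // IH // jordan_poly_map.
Qed.

Variable half : M.
Hypotheses (halfD : half + half = 1) (half_star : star half = half).
Hypothesis half_central : forall x : B, v half * x = x * v half.
Hypothesis torsion_free : forall (x : B) n, x *+ n.+1 = 0 -> x = 0.

Let diamond_half x : diamond (v half) x = x.
Proof.
by rewrite /diamond -v_star half_star -half_central -mulrDl -rmorphD halfD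
  rmorph1 mul1r.
Qed.

Variable n : nat.
Hypothesis n_ge2 : (2 <= n)%N.
Hypothesis delta_jordan_poly : forall s, size s = n ->
  delta (jordan_poly s) = leibniz_sum s.

(** With [E k] the Leibniz sum at k + 1 copies of 1/2 and [rho x] the real part of
    x, one has [E k.+1 = rho (E k) + delta half], so that [rho (E k)] is k + 1
    times [rho (delta half)].  The identity at (1/2, ..., 1/2, c) says that
    [diamond (E m) c = 0] for all c, which forces [rho (delta half) = 0]. *)
Lemma jordan_diamond (v_inj : injective v) a b : delta (diamond a b) =
  diamond (delta a) (v b) + diamond (v a) (delta b).
Proof.
case: n n_ge2 delta_jordan_poly => [//|[//|m]] _ hd.
have dh c : diamond half c = c.
  by apply: v_inj; rewrite -[RHS]diamond_half /diamond rmorphD !rmorphM v_star.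
have jh k c : jordan_poly (rcons (nseq k.+1 half) c) = c.
  elim: k c => [|k IH] c; first exact: dh.
  by rewrite jordan_poly_rcons // -[k.+2]addn1 nseqD cats1 IH dh.
pose E k := leibniz_sum (nseq k.+1 half).
have nseq_rcons k : nseq k.+2 half = rcons (nseq k.+1 half) half.
  by rewrite -[k.+2]addn1 nseqD cats1.
have vjh k : jordan_poly (map v (nseq k.+1 half)) = v half.
  case: k => [//|k]; by rewrite jordan_poly_map nseq_rcons jh.
have leib_half k c : leibniz_sum (rcons (nseq k.+1 half) c) =
    diamond (E k) (v c) + delta c.
  by rewrite leibniz_sum_rcons // vjh diamond_half.
pose rho x := diamond x (v half).
have rho_idem x : rho (rho x) = rho x.
  have h : star (rho x) = rho x.
    rewrite /rho /diamond starD !starM starK -v_star half_star addrC.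
    by rewrite half_central -half_central.
  rewrite {1}/rho /diamond h half_central -mulrDr -rmorphD halfD.
  by rewrite rmorph1 mulr1.
have E0 : E 0%N = delta half by exact: leibniz_sum1.
have ES k : E k.+1 = rho (E k) + delta half by rewrite /E nseq_rcons leib_half.
have rhoE k : rho (E k) = rho (delta half) *+ k.+1.
  elim: k => [|k IH]; first by rewrite E0.
  by rewrite ES [LHS]diamondDl -!/(rho _) rho_idem IH -mulrSr.
have Em c : diamond (E m) (v c) = 0.
  have := hd (rcons (nseq m.+1 half) c).
  rewrite size_rcons size_nseq => /(_ erefl); rewrite jh leib_half => h.
  by apply: (addIr (delta c)); rewrite add0r -h.
have rho0 : rho (delta half) = 0.
  by apply: (@torsion_free _ m); rewrite -rhoE; exact: Em.
have EE k : E k = delta half.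
  by case: k => [//|k]; rewrite ES rhoE rho0 mul0rn add0r.
case: m hd Em => [|m] hd Em.
  rewrite -[diamond a b]/(jordan_poly [:: a; b]) hd //.
  by rewrite -[[:: a; b]]/(rcons [:: a] b) leibniz_sum_rcons // leibniz_sum1.
have := hd (rcons (rcons (nseq m.+1 half) a) b).
rewrite !size_rcons size_nseq => /(_ erefl).
rewrite jordan_poly_rcons -?size_eq0 ?size_rcons // jh => ->.
rewrite leibniz_sum_rcons -?size_eq0 ?size_rcons // jordan_poly_map jh leib_half.
by have := Em a; rewrite !EE => ->; rewrite add0r.
Qed.

End PolynomialIdentity.

(** * The underlying real Hilbert space *)

Section RealInnerProduct.
Variables (R : realType) (H : hilbertType R).
Implicit Types (x y z : H) (A : 'B(H)) (t : R).

(** The real part of the inner product and the real-valued norm determine the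
    Hilbert space structure, and take values in an ordered field. *)
Definition rip x y : R := complex.Re (inner x y).
Definition rnorm x : R := complex.Re `|x|.

Lemma normr_rnorm x : `|x| = (rnorm x)%:C.
Proof. exact/ge0_ReE. Qed.

Lemma rnorm_ge0 x : 0 <= rnorm x.
Proof. by rewrite -lecR -normr_rnorm; exact: normr_ge0. Qed.

Lemma rnormD x y : rnorm (x + y) <= rnorm x + rnorm y.
Proof. by rewrite -lecR rmorphD /= -!normr_rnorm ler_normD. Qed.

Lemma rnormN x : rnorm (- x) = rnorm x.
Proof. by rewrite /rnorm normrN. Qed.

Lemma rnormB x y : rnorm (x - y) <= rnorm x + rnorm y.
Proof. by rewrite (le_trans (rnormD _ _)) // rnormN. Qed.

Lemma rnormZ t x : 0 <= t -> rnorm (t%:C *: x) = t * rnorm x.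
Proof.
by move=> t0; rewrite /rnorm normrZ ger0_norm ?lecR // Re_realM.
Qed.

Lemma rnorm_eq0 x : rnorm x = 0 -> x = 0.
Proof. by move=> h; apply/eqP; rewrite -normr_eq0 normr_rnorm h. Qed.

Lemma rnorm0 : rnorm 0 = 0.
Proof. by rewrite /rnorm normr0. Qed.

Lemma ripE x : rip x x = rnorm x ^+ 2.
Proof.
by rewrite /rip -normr_inner normr_rnorm -rmorphXn.
Qed.

Lemma ripC x y : rip x y = rip y x.
Proof. by rewrite /rip innerC; exact: Defs.Re_conj. Qed.

Lemma ripDl x y z : rip (x + y) z = rip x z + rip y z.
Proof. by rewrite /rip innerDl raddfD. Qed.

Lemma ripDr x y z : rip x (y + z) = rip x y + rip x z.
Proof. by rewrite !(ripC x) ripDl. Qed.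

Lemma ripZl t x y : rip (t%:C *: x) y = t * rip x y.
Proof. by rewrite /rip innerZl; exact: Re_realM. Qed.

Lemma ripZr t x y : rip x (t%:C *: y) = t * rip x y.
Proof. by rewrite !(ripC x) ripZl. Qed.

Lemma ripNl x y : rip (- x) y = - rip x y.
Proof. by rewrite -scaleN1r -(rmorphN1 (real_complex R)) ripZl mulN1r. Qed.

Lemma ripNr x y : rip x (- y) = - rip x y.
Proof. by rewrite !(ripC x) ripNl. Qed.

Lemma rip0l y : rip 0 y = 0.
Proof. by rewrite /rip -(scale0r 0) innerZl mul0r. Qed.

Definition rip_linear := (ripDl, ripDr, ripNl, ripNr, ripZl, ripZr).

Lemma rip_le x y : rip x y <= rnorm x * rnorm y.
Proof.
rewrite -lecR rmorphM /= -!normr_rnorm; apply: le_trans (cauchy_schwarz x y).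
apply: le_trans (normc_ge_Re _); rewrite lecR; exact: ler_norm.
Qed.

Lemma ler_rip x y : `|rip x y| <= rnorm x * rnorm y.
Proof.
by rewrite ler_norml rip_le andbT lerNl -ripNl -(rnormN x) rip_le.
Qed.

Lemma rip_star A x y : rip (A x) y = rip x (star A y).
Proof. by rewrite /rip adjointP. Qed.

Lemma rip_starl A x y : rip (star A x) y = rip x (A y).
Proof. by rewrite rip_star starK. Qed.

Lemma rip_inj x y : (forall z, rip x z = rip y z) -> x = y.
Proof.
move=> h; apply/subr0_eq/rnorm_eq0/eqP; rewrite -sqrf_eq0 -ripE.
by rewrite ripDl ripNl h subrr.
Qed.

Lemma rip_i x y : complex.Im (inner x y) = rip x ('i *: y).
Proof. by rewrite /rip innerZr; case: (inner x y) => a b /=; lra. Qed.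

Lemma normci : `|'i : R[i]| = 1.
Proof. by rewrite normc_def /= expr0n add0r expr1n sqrtr1. Qed.

(** A real functional f is the real part of the complex-linear functional
    x |-> f x - i f (i x), to which the complex representation theorem
    applies. *)
Lemma real_riesz (f : H -> R) (c : R) : (forall x y, f (x + y) = f x + f y) ->
  (forall t x, f (t%:C *: x) = t * f x) ->
  (forall x, `|f x| <= c * rnorm x) -> exists y, forall x, f x = rip y x.
Proof.
move=> fD fZ fc.
have fN x : f (- x) = - f x.
  by rewrite -scaleN1r -(rmorphN1 (real_complex R)) fZ mulN1r.
pose F x : R[i]^o := (f x)%:C - 'i * (f ('i *: x))%:C.
have Flin : linear F.
  move=> [a b] x y.
  have e : a +i* b = a%:C + b%:C * 'i :> R[i] 
    by rewrite [LHS]complexE; congr (_ + _); exact: mulrC.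
  have eZ z : f ((a +i* b) *: z) = a * f z + b * f ('i *: z).
    by rewrite e scalerDl fD fZ -scalerA fZ.
  have ii z : 'i *: ('i *: z) = - z :> H.
    by rewrite scalerA -expr2 sqr_i scaleN1r.
  have iC (z : R[i]) u : 'i *: (z *: u) = z *: ('i *: u) :> H.
    by rewrite !scalerA mulrC.
  rewrite /F !scalerDr iC !fD !eZ ii fN.
  by rewrite /GRing.scale /=; apply/eqP; rewrite eq_complex /=;
    apply/andP; split; apply/eqP; lra.
pose Fl : {linear H -> R[i]^o} := HB.pack F (GRing.isLinear.Build _ _ _ _ _ Flin).
have [y Fy] : exists y, forall x, F x = inner x y.
  apply: (@riesz _ _ Fl (c + c)%:C) => x /=.
  rewrite /F (le_trans (ler_normB _ _)) // normr_rnorm -rmorphM mulrDl rmorphD /=.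
  rewrite normrM normci mul1r.
  have fcx z : `|(f z)%:C| <= (c * rnorm z)%:C :> R[i].
    by rewrite normc_def /= expr0n addr0 sqrtr_sqr lecR.
  rewrite lerD //; have := fcx ('i *: x).
  by rewrite /rnorm normrZ normci mul1r.
by exists y => x; rewrite ripC /rip -Fy /F /=; lra.
Qed.

(** The condition on i makes the operator that represents the form
    complex-linear. *)
Lemma bounded_form (f : H -> H -> R) (c : R) :
  (forall x y z, f (x + y) z = f x z + f y z) ->
  (forall x y z, f x (y + z) = f x y + f x z) ->
  (forall t x y, f (t%:C *: x) y = t * f x y) ->
  (forall t x y, f x (t%:C *: y) = t * f x y) ->
  (forall x y, f ('i *: x) y = - f x ('i *: y)) ->
  (forall x y, `|f x y| <= c * rnorm x * rnorm y) ->
  exists L : 'B(H), forall x y, f x y = rip (L x) y.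
Proof.
move=> fDl fDr fZl fZr fi fc.
have [g gP] : {g : H -> H & forall x y, f x y = rip (g x) y}.
  apply: (@choice H H (fun x z => forall y, f x y = rip z y)) => x.
  exact: (@real_riesz _ (c * rnorm x)).
have gb : g \in @bounded_linear R H.
  apply/asboolP; split.
    move=> [a b] x y; apply: rip_inj => z.
    have e : a +i* b = a%:C + b%:C * 'i :> R[i] 
    by rewrite [LHS]complexE; congr (_ + _); exact: mulrC.
    rewrite -gP fDl e scalerDl -scalerA fDl !fZl fi !gP.
    rewrite scalerDl -scalerA !rip_linear; congr (_ + _ + _).
    congr (_ * _); rewrite /rip innerZl innerZr.
    by case: (inner (g x) z) => p q /=; lra.
  exists c%:C => x; rewrite !normr_rnorm -rmorphM lecR.
  have [->|gx0] := eqVneq (rnorm (g x)) 0.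
    have [x0|x0] := eqVneq (rnorm x) 0; first by rewrite x0 mulr0.
    have := le_trans (normr_ge0 _) (fc x x).
    by rewrite pmulr_lge0 // lt_neqAle eq_sym x0 rnorm_ge0.
  have gx : 0 < rnorm (g x) by rewrite lt_neqAle eq_sym gx0 rnorm_ge0.
  rewrite -(ler_pM2r gx) -expr2 -ripE -gP.
  exact: le_trans (ler_norm _) (fc _ _).
by exists (BoundedOp gb) => x y; rewrite gP.
Qed.

(** * Weak limits of operators *)

Lemma ultra_cvg_segment (T : Type) (G : set_system T) (f : T -> R) (c : R) :
  UltraFilter G -> G [set u | `|f u| <= c] -> exists l : R, f u @[u --> G] --> l.
Proof.
move=> GU Gc.
have Gs : G (f @^-1` `[- c, c]%classic).
  by apply: filterS Gc => u /=; rewrite in_itv /= ler_norml.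
have [l [_ fl]] := @segment_compact R (- c) c (f @ G) _ Gs.
exists l => U Ul; have [//|GnU] := in_ultra_setVsetC (f @^-1` U) GU.
by have [z [nUz Uz]] := fl (~` U) U GnU Ul.
Qed.

(** Weak compactness of balls of operators: along an ultrafilter all coefficients
    converge, and the limits are the real part of a bounded sesquilinear form. *)
Lemma weak_limit (F : set_system 'B(H)) (c : R) : ProperFilter F ->
  F [set A : 'B(H) | forall x, rnorm (A x) <= c * rnorm x] ->
  exists G (L : 'B(H)), [/\ UltraFilter G, F `<=` G &
    forall x y, rip (A x) y @[A --> G] --> rip (L x) y].
Proof.
move=> FF Fc; have [G [GU FG]] := ultraFilterLemma FF.
have Gc : G [set A : 'B(H) | forall x, rnorm (A x) <= c * rnorm x] by exact: FG.
have bnd x y : G [set A : 'B(H) | `|rip (A x) y| <= c * rnorm x * rnorm y].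
  apply: filterS Gc => A /= Ac; apply: le_trans (ler_rip _ _) _.
  by rewrite ler_wpM2r ?rnorm_ge0.
have [f fP] : {f : H * H -> R & forall p, rip (A p.1) p.2 @[A --> G] --> f p}.
  apply: (@choice (H * H)%type R (fun p l => rip (A p.1) p.2 @[A --> G] --> l)).
  by move=> [x y] /=; have := ultra_cvg_segment GU (bnd x y).
pose g x y := f (x, y); have gP x y : rip (A x) y @[A --> G] --> g x y.
  exact: (fP (x, y)).
have lim_eq (h : 'B(H) -> R) x y l : (forall A, h A = rip (A x) y) ->
    h A @[A --> G] --> l -> g x y = l.
  move=> /funext -> hl; exact: (cvg_unique _ (gP x y) hl).
have [L LP] : exists L : 'B(H), forall x y, g x y = rip (L x) y.
  apply: (@bounded_form _ c).
  - move=> x y z; apply: (lim_eq (fun A => rip (A x) z + rip (A y) z)).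
      by move=> A; rewrite linearD ripDl.
    by apply: cvgD; exact: gP.
  - move=> x y z; apply: (lim_eq (fun A => rip (A x) y + rip (A x) z)).
      by move=> A; rewrite ripDr.
    by apply: cvgD; exact: gP.
  - move=> t x y; apply: (lim_eq (fun A => t * rip (A x) y)).
      by move=> A; rewrite linearZ ripZl.
    by apply: cvgMr; exact: gP.
  - move=> t x y; apply: (lim_eq (fun A => t * rip (A x) y)).
      by move=> A; rewrite ripZr.
    by apply: cvgMr; exact: gP.
  - move=> x y; apply: (lim_eq (fun A => - rip (A x) ('i *: y))).
      move=> A; rewrite linearZ /= /rip innerZl innerZr.
      by case: (inner (A x) y) => p q /=; lra.
    by apply: cvgN; exact: gP.
  - move=> x y; rewrite ler_norml; apply/andP; split.
      apply: (cvgr_to_ge (gP x y)).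
      have : G [set A : 'B(H) | - (c * rnorm x * rnorm y) <= rip (A x) y].
        by apply: filterS (bnd x y) => A /=; rewrite ler_norml => /andP[].
      by [].
    apply: (cvgr_to_le (gP x y)).
    have : G [set A : 'B(H) | rip (A x) y <= c * rnorm x * rnorm y].
      by apply: filterS (bnd x y) => A /=; rewrite ler_norml => /andP[].
    by [].
by exists G, L; split=> // x y; rewrite -LP.
Qed.

(** The imaginary part of [inner (A x) y] is [rip (A x) (i y)], so convergence of
    the real coefficients is convergence in the weak operator topology. *)
Lemma vna_weak_limit (M : vonNeumannAlgebra H) (G : set_system 'B(H)) (L : 'B(H)) :
  ProperFilter G -> G [set A | A \in vna_pred M] ->
  (forall x y, rip (A x) y @[A --> G] --> rip (L x) y) -> L \in vna_pred M.
Proof.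
move=> GF GM GL.
have cvgc x y : (inner (A x) y : R[i]^o) @[A --> G] --> (inner (L x) y : R[i]^o).
  apply/cvgrPdist_lt => e e0.
  have [r r0 ->] : exists2 r : R, 0 < r & e = r%:C.
    by move: e0; case: e => a b; rewrite ltcE /= => /andP[/eqP -> ?]; exists a.
  have r20 : 0 < r / 2 by rewrite divr_gt0.
  have /cvgrPdist_lt/(_ _ r20) G1 := GL x y.
  have /cvgrPdist_lt/(_ _ r20) G2 := GL x ('i *: y).
  apply: filterS2 G1 G2 => A; rewrite -!rip_i /rip.
  case: (inner (L x) y) => a b; case: (inner (A x) y) => a' b' /= h1 h2.
  rewrite [_ - _]complexE /= (le_lt_trans (ler_normD _ _)) //.
  rewrite normrM normci mul1r.
  have nC (t : R) : `|t%:C| = `|t|%:C :> R[i].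
    by rewrite normc_def /= expr0n addr0 sqrtr_sqr.
  rewrite !nC -rmorphD ltcR; lra.
have GLp : matrix_coef A @[A --> G] --> (matrix_coef L : {ptws H * H -> R[i]^o}).
  by apply/pointwise_cvgP => -[x y]; exact: cvgc.
have GLw : G --> (L : wot H).
  move=> U [_ [[W oW <-] WL]]; move=> WU; have GW : G (@matrix_coef R H @^-1` W).
    by apply: GLp; exact: open_nbhs_nbhs.
  exact: filterS GW.
exact: (@closed_cvg _ (wot H) G _ id _ (vna_closed (v:=M)) GM L GLw).
Qed.

End RealInnerProduct.

(** * Square roots and kernel projections *)

Section Operators.
Variables (R : realType) (H : hilbertType R).
Implicit Types (x y z : H) (A B : 'B(H)) (t : R).

Lemma bopDE A B x : (A + B) x = A x + B x. Proof. by []. Qed.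
Lemma bopNE A x : (- A) x = - A x. Proof. by []. Qed.
Lemma bopME A B x : (A * B) x = A (B x). Proof. by []. Qed.
Lemma bop1E x : (1 : 'B(H)) x = x. Proof. by []. Qed.
Lemma bop0E x : (0 : 'B(H)) x = 0. Proof. by []. Qed.
Lemma bopZE (c : R[i]) A x : (c *: A) x = c *: A x. Proof. by []. Qed.
Definition bopE := (bopDE, bopNE, bopME, bop1E, bop0E, bopZE).

Lemma bopZAl (c : R[i]) A B : (c *: A) * B = c *: (A * B).
Proof. exact: bopP. Qed.

Lemma bopZAr (c : R[i]) A B : A * (c *: B) = c *: (A * B).
Proof. by apply: bopP => x; rewrite !bopE linearZ. Qed.

Definition contraction A := forall x, rnorm (A x) <= rnorm x.

Lemma bop_rbounded A : exists2 c : R, 0 < c & forall x, rnorm (A x) <= c * rnorm x.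
Proof.
have [M AM] := bop_bounded A.
exists (Num.max 1 (complex.Re M)); first by rewrite lt_max ltr01.
move=> x; have := AM x; rewrite !normr_rnorm; case: M AM => a b _.
rewrite lecE /= => /andP[_ h]; have {}h : rnorm (A x) <= a * rnorm x by lra.
by apply: le_trans h _; rewrite ler_wpM2r ?rnorm_ge0 // le_max lexx orbT.
Qed.

Lemma le_eps (z c : R) : 0 <= c -> (forall e, 0 < e -> z <= c * e) -> z <= 0.
Proof.
move=> c0 h; rewrite leNgt; apply/negP => z0.
have c1 : 0 < c + 1 by lra.
have := h (z / (c + 1)); rewrite divr_gt0 // => /(_ isT).
rewrite mulrA ler_pdivlMr //; nra.
Qed.

Lemma rnorm_le_eps x (c : R) : 0 <= c -> (forall e, 0 < e -> rnorm x <= c * e) ->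
  x = 0.
Proof.
by move=> c0 h; apply: rnorm_eq0; apply/eqP; rewrite eq_le rnorm_ge0 (le_eps c0 h).
Qed.

Lemma selfadjointP A : star A = A <-> forall x y, rip (A x) y = rip x (A y).
Proof.
split=> [h x y|h]; first by rewrite rip_star h.
by apply: bopP => x; apply: rip_inj => y; rewrite rip_starl h.
Qed.

Variable M : vonNeumannAlgebra H.

(** A weak limit point of a norm-Cauchy sequence is its norm limit, because balls
    are weakly closed. *)
Lemma vna_norm_limit (Y : nat -> 'B(H)) (e : nat -> R) :
  (forall n, Y n \in vna_pred M) ->
  (forall n m x, (n <= m)%N -> rnorm ((Y m - Y n) x) <= e n * rnorm x) ->
  exists2 L : 'B(H), L \in vna_pred M &
    forall n x, rnorm ((L - Y n) x) <= e n * rnorm x.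
Proof.
move=> YM Ye; have [c0 c0_gt0 Yc0] := bop_rbounded (Y 0%N).
pose F : set_system 'B(H) := Y n @[n --> \oo].
have FF : ProperFilter F by exact: fmap_proper_filter.
have Fc : F [set A : 'B(H) | forall x, rnorm (A x) <= (e 0%N + c0) * rnorm x].
  exists 0%N => // n _ x /=.
  have -> : Y n x = (Y n - Y 0%N) x + Y 0%N x by rewrite !bopE subrK.
  by apply: le_trans (rnormD _ _) _; rewrite mulrDl lerD // Ye.
have [G [L [GU FG GL]]] := weak_limit FF Fc.
exists L.
  by apply: vna_weak_limit GL; apply: FG; exists 0%N => // n _ /=.
move=> n x.
have [->|z0] := eqVneq (rnorm ((L - Y n) x)) 0.
  by rewrite (le_trans (rnorm_ge0 ((Y n - Y n) x))) // Ye.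
set z := (L - Y n) x in z0 *.
have zgt : 0 < rnorm z by rewrite lt_neqAle eq_sym z0 rnorm_ge0.
rewrite -(ler_pM2r zgt) -expr2 -ripE {1}/z !bopE ripDl ripNl lerBlDr.
apply: (cvgr_to_le (GL x z)).
have : G [set A : 'B(H) | rip (A x) z <= e n * rnorm x * rnorm z + rip (Y n x) z].
  apply: FG; exists n => // m /= nm.
  rewrite -lerBlDr -ripNl -ripDl; apply: le_trans (rip_le _ _) _.
  by rewrite ler_wpM2r ?rnorm_ge0 //; exact: Ye.
by [].
Qed.


Lemma vna_half A : A \in vna_pred M -> (2^-1)%:C *: A \in vna_pred M.
Proof. exact: vna_scale. Qed.

(** The iteration y |-> (u + y ^ 2) / 2 converges to 1 - sqrt (1 - u).  The same
    iteration for u = 1 in the reals dominates it: all its iterates are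
    polynomials with nonnegative coefficients. *)
Fixpoint sqrt_iter (u : 'B(H)) n : 'B(H) :=
  if n is m.+1 then (2^-1)%:C *: (u + sqrt_iter u m * sqrt_iter u m) else 0.

Fixpoint sqrt_majorant n : R :=
  if n is m.+1 then 2^-1 * (1 + sqrt_majorant m * sqrt_majorant m) else 0.

Lemma sqrt_iterS u n :
  sqrt_iter u n.+1 = (2^-1)%:C *: (u + sqrt_iter u n * sqrt_iter u n).
Proof. by []. Qed.

Lemma sqrt_majorantS n :
  sqrt_majorant n.+1 = 2^-1 * (1 + sqrt_majorant n * sqrt_majorant n).
Proof. by []. Qed.

Lemma sqrt_majorant_bounds n : 0 <= sqrt_majorant n <= 1.
Proof. by elim: n => [|n /andP[h1 h2]] /=; [rewrite lexx ler01|nra]. Qed.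

Lemma sqrt_majorant_le n : sqrt_majorant n <= sqrt_majorant n.+1.
Proof. by rewrite /=; have := sqr_ge0 (sqrt_majorant n - 1); nra. Qed.

Lemma sqrt_iter_bound u n x : contraction u ->
  rnorm (sqrt_iter u n x) <= sqrt_majorant n * rnorm x.
Proof.
move=> uc; elim: n x => [|n IH] x; first by rewrite mul0r [leLHS]rnorm0.
rewrite sqrt_iterS !bopE rnormZ ?invr_ge0 // -mulrA ler_wpM2l ?invr_ge0 //.
rewrite (le_trans (rnormD _ _)) // mulrDl mul1r lerD // -mulrA.
apply: le_trans (IH _) _; rewrite ler_wpM2l //.
by have /andP[] := sqrt_majorant_bounds n.
Qed.

Lemma sqrt_iter_step u n x : contraction u ->
  rnorm ((sqrt_iter u n.+1 - sqrt_iter u n) x) <=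
  (sqrt_majorant n.+1 - sqrt_majorant n) * rnorm x.
Proof.
move=> uc; elim: n x => [|n IH] x.
  have -> : sqrt_iter u 1 - sqrt_iter u 0 = (2^-1)%:C *: u.
    by rewrite sqrt_iterS /= mulr0 addr0 subr0.
  have -> : sqrt_majorant 1 - sqrt_majorant 0 = 2^-1 by rewrite /=; lra.
  rewrite bopZE rnormZ ?invr_ge0 //.
  by rewrite ler_wpM2l ?invr_ge0.
set Y1 := sqrt_iter u n.+1 in IH *; set Y0 := sqrt_iter u n in IH *.
set r1 := sqrt_majorant n.+1 in IH *; set r0 := sqrt_majorant n in IH *.
have -> : sqrt_iter u n.+2 - Y1 =
    (2^-1)%:C *: (Y1 * (Y1 - Y0) + (Y1 - Y0) * Y0).
  have E2 := sqrt_iterS u n.+1; have E1 := sqrt_iterS u n.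
  rewrite -/Y1 in E2; rewrite -/Y1 -/Y0 in E1.
  rewrite E2 {2}E1 -scalerBr; congr (_ *: _); ncring.
have -> : sqrt_majorant n.+2 - r1 = 2^-1 * (r1 * (r1 - r0) + (r1 - r0) * r0).
  rewrite sqrt_majorantS -/r1; have := sqrt_majorantS n; rewrite -/r1 -/r0; lra.
rewrite bopZE bopDE !bopME rnormZ ?invr_ge0 // -mulrA ler_wpM2l ?invr_ge0 //.
rewrite (le_trans (rnormD _ _)) // mulrDl lerD //.
  apply: le_trans (sqrt_iter_bound _ _ uc) _; rewrite -mulrA ler_wpM2l //.
  by have /andP[] := sqrt_majorant_bounds n.+1.
apply: le_trans (IH _) _; rewrite -mulrA ler_wpM2l //.
  by rewrite subr_ge0 sqrt_majorant_le.
exact: sqrt_iter_bound.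
Qed.

Lemma sqrt_iter_cauchy u n m x : contraction u -> (n <= m)%N ->
  rnorm ((sqrt_iter u m - sqrt_iter u n) x) <=
  (sqrt_majorant m - sqrt_majorant n) * rnorm x.
Proof.
move=> uc; elim: m => [|m IH]; first by case: n => // _; rewrite !subrr rnorm0 mul0r.
rewrite leq_eqVlt => /predU1P[->|]; first by rewrite !subrr rnorm0 mul0r.
rewrite ltnS => /IH h.
rewrite -(subrK (sqrt_iter u m) (sqrt_iter u m.+1)) -addrA bopDE.
apply: le_trans (rnormD _ _) _; apply: le_trans (lerD (sqrt_iter_step _ _ uc) h) _.
lra.
Qed.

(** The equation says that (1 - y) ^ 2 = 1 - u. *)
Lemma vna_sqrt (u : 'B(H)) : u \in vna_pred M -> star u = u -> contraction u ->
  exists y : 'B(H), [/\ y \in vna_pred M, star y = y, contraction y,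
    y + y = u + y * y & forall b : 'B(H), u * b = b * u -> y * b = b * y].
Proof.
move=> uM us uc; pose Y := sqrt_iter u; pose r := sqrt_majorant.
pose rho := sup (range r).
have r_sup : has_sup (range r).
  split; first by exists (r 0%N), 0%N.
  by exists 1 => _ [n _ <-]; have /andP[] := sqrt_majorant_bounds n.
have r_le n : r n <= rho by apply: (ub_le_sup r_sup.2); exists n.
have YM n : Y n \in vna_pred M.
  elim: n => [|n IH]; first exact: rpred0.
  by apply: vna_half; rewrite rpredD // rpredM.
have Yb b n : u * b = b * u -> Y n * b = b * Y n.
  move=> ub; elim: n => [|n IH]; first by rewrite [LHS]mul0r [RHS]mulr0.
  rewrite /Y sqrt_iterS -/Y bopZAl bopZAr; congr (_ *: _).
  by rewrite mulrDl mulrDr ub -mulrA IH mulrA IH mulrA.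
have Ys n : star (Y n) = Y n.
  elim: n => [|n IH]; first by rewrite [LHS]star0.
  apply/selfadjointP => x z; rewrite /Y sqrt_iterS -/Y !bopE ripZl ripZr.
  by congr (_ * _); rewrite ripDl ripDr !rip_star us IH.
have Yc n : contraction (Y n).
  move=> x; apply: le_trans (sqrt_iter_bound _ _ uc) _.
  rewrite -[leRHS]mul1r ler_wpM2r ?rnorm_ge0 //.
  by have /andP[] := sqrt_majorant_bounds n.
have [|y yM yY] := @vna_norm_limit Y (fun n => rho - r n) YM.
  move=> n m x nm; apply: le_trans (sqrt_iter_cauchy _ uc nm) _.
  by rewrite ler_wpM2r ?rnorm_ge0 // lerD2r.
have approx e : 0 < e -> exists n,
    (forall z, rnorm ((y - Y n) z) <= e * rnorm z) /\
    (forall z, rnorm ((y - Y n.+1) z) <= e * rnorm z).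
  move=> e0; have [_ [n _ <-] rn] := sup_adherent e0 r_sup.
  have rn1 := sqrt_majorant_le n; rewrite -/rho -/r in rn rn1.
  exists n; split=> z; apply: le_trans (yY _ z) _;
    rewrite ler_wpM2r ?rnorm_ge0 //; lra.
have op_eq0 (A : 'B(H)) (c : H -> R) : (forall x, 0 <= c x) ->
    (forall e n x, 0 < e -> (forall z, rnorm ((y - Y n) z) <= e * rnorm z) ->
      (forall z, rnorm ((y - Y n.+1) z) <= e * rnorm z) ->
      rnorm (A x) <= c x * e) -> A = 0.
  move=> c0 h; apply: bopP => x; apply: (@rnorm_le_eps _ (c x)) => // e e0.
  by have [n [yn yn1]] := approx _ e0; apply: (h _ n).
have yc : contraction y.
  move=> x; rewrite -subr_le0; apply: (@le_eps _ (rnorm x)); first exact: rnorm_ge0.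
  move=> e e0; have [n [yn _]] := approx _ e0.
  have -> : y x = (y - Y n) x + Y n x by rewrite !bopE subrK.
  by have := rnormD ((y - Y n) x) (Y n x); have := yn x; have := Yc n x; lra.
exists y; split=> //.
- apply/selfadjointP => x w; apply/subr0_eq/normr0_eq0/eqP.
  rewrite eq_le normr_ge0 andbT.
  apply: (@le_eps _ (2 * (rnorm x * rnorm w))) => [|e e0].
    by rewrite !mulr_ge0 ?rnorm_ge0.
  have [n [yn _]] := approx _ e0.
  have -> : rip (y x) w - rip x (y w) =
      rip ((y - Y n) x) w - rip x ((y - Y n) w).
    have := (selfadjointP (Y n)).1 (Ys n) x w.
    by rewrite !bopE ripDl ripNl ripDr ripNr => ->; lra.
  have h1 := ler_rip ((y - Y n) x) w; have h2 := ler_rip x ((y - Y n) w).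
  have h3 : rnorm ((y - Y n) x) * rnorm w <= e * rnorm x * rnorm w.
    by rewrite ler_wpM2r ?rnorm_ge0.
  have h4 : rnorm x * rnorm ((y - Y n) w) <= rnorm x * (e * rnorm w).
    by rewrite ler_wpM2l ?rnorm_ge0.
  apply: le_trans (ler_normB _ _) _; lra.
- apply/subr0_eq; apply: (op_eq0 _ (fun x => 4 * rnorm x)).
    by move=> x; rewrite mulr_ge0 ?rnorm_ge0.
  move=> e n x e0 yn yn1.
  have -> : y + y - (u + y * y) = (y - Y n.+1) + (y - Y n.+1) -
     (Y n * (y - Y n) + (y - Y n) * y).
    have : Y n.+1 + Y n.+1 = u + Y n * Y n.
      rewrite /Y sqrt_iterS -/Y -scalerDl -rmorphD.
      have -> : 2^-1 + 2^-1 = 1 :> R by lra.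
      by rewrite rmorph1 scale1r.
    move=> /(congr1 (fun A => A - (u + Y n * Y n))); rewrite subrr => h.
    by rewrite -[LHS]subr0 -[in LHS]h; ncring.
  set z := (X in rnorm X).
  have {z}-> : z = (y - Y n.+1) x + (y - Y n.+1) x -
      (Y n ((y - Y n) x) + (y - Y n) (y x)) by [].
  have h1 := Yc n ((y - Y n) x).
  have h2 := yn (y x); have h3 := yc x; have h4 := yn x; have h5 := yn1 x.
  have h6 : e * rnorm (y x) <= e * rnorm x by rewrite ler_wpM2l // ltW.
  apply: le_trans (rnormB _ _) _.
  have h7 := rnormD ((y - Y n.+1) x) ((y - Y n.+1) x).
  have h8 := rnormD (Y n ((y - Y n) x)) ((y - Y n) (y x)).
  lra.
- move=> b ub; have [c c0 bc] := bop_rbounded b.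
  apply/subr0_eq; apply: (op_eq0 _ (fun x => (c + c) * rnorm x)).
    by move=> x; rewrite mulr_ge0 ?rnorm_ge0 // addr_ge0 // ltW.
  move=> e n x e0 yn _.
  have -> : y * b - b * y = (y - Y n) * b - b * (y - Y n).
    have h := Yb b n ub.
    have -> : (y - Y n) * b - b * (y - Y n) = y * b - b * y - (Y n * b - b * Y n).
      by ncring.
    by rewrite h subrr subr0.
  set z := (X in rnorm X).
  have {z}-> : z = (y - Y n) (b x) - b ((y - Y n) x) by [].
  apply: le_trans (rnormB _ _) _.
  have h1 := yn (b x); have h2 := bc ((y - Y n) x); have h3 := yn x.
  have h4 := bc x.
  have h5 : e * rnorm (b x) <= e * (c * rnorm x) by rewrite ler_wpM2l // ltW.
  have h6 : c * rnorm ((y - Y n) x) <= c * (e * rnorm x) by rewrite ler_wpM2l // ltW.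
  lra.
Qed.

(** X is a convex combination of multiples of c^* c, c in s.  The third property,
    which expresses 0 <= X <= 1 and is stable under averages, makes 1 - X a
    contraction. *)
Lemma dominating_operator (C : set 'B(H)) (s : seq 'B(H)) :
  (forall c, C c -> c \in vna_pred M) -> (forall c, c \in s -> C c) ->
  exists X : 'B(H), exists b : R, [/\ [/\ X \in vna_pred M, star X = X & 0 <= b],
    forall x, (forall c, C c -> c x = 0) -> X x = 0,
    forall x, rnorm (X x) ^+ 2 <= rip (X x) x &
    forall c x, c \in s -> rnorm (c x) ^+ 2 <= b * rip (X x) x].
Proof.
move=> CM; elim: s => [|c s IH] sC.
  exists 0, 0; split=> //.
  - by split; [exact: rpred0|exact: star0|].
  - by move=> x; rewrite bop0E rnorm0 rip0l expr0n.
have [|X [b [[XM Xs b0] XN Xpos Xdom]]] := IH.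
  by move=> d ds; apply: sC; rewrite in_cons ds orbT.
have cM : c \in vna_pred M by apply/CM/sC; rewrite in_cons eqxx.
have [k k0 ck] := bop_rbounded (star c).
pose Z := (k ^- 2)%:C *: (star c * c).
have ZE x : Z x = (k ^- 2)%:C *: star c (c x) by [].
have Zs x y : rip (Z x) y = rip x (Z y).
  by rewrite !ZE ripZl ripZr rip_starl rip_star.
have ripZ x : rip (Z x) x = k ^- 2 * rnorm (c x) ^+ 2.
  by rewrite ZE ripZl rip_starl ripE.
have ki : 0 <= k ^- 2 by rewrite invr_ge0 exprn_ge0 // ltW.
have Zpos x : rnorm (Z x) ^+ 2 <= rip (Z x) x.
  rewrite ripZ ZE rnormZ // exprMn.
  have h : rnorm (star c (c x)) ^+ 2 <= (k * rnorm (c x)) ^+ 2.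
    by rewrite ler_pXn2r ?nnegrE ?rnorm_ge0 ?mulr_ge0 ?rnorm_ge0 // ltW.
  apply: le_trans (ler_wpM2l (sqr_ge0 _) h) _.
  have kk : k ^- 2 * k ^+ 2 = 1 by rewrite mulVf // expf_neq0 // gt_eqF.
  by rewrite exprMn (expr2 (k ^- 2)) -mulrA (mulrA (k ^- 2) (k ^+ 2)) kk mul1r.
exists ((2^-1)%:C *: (X + Z)), (2 * b + 2 * k ^+ 2).
pose W := (2^-1)%:C *: (X + Z); rewrite -/W.
have WE x : W x = (2^-1)%:C *: (X x + Z x) by [].
have ripW x : rip (W x) x = 2^-1 * (rip (X x) x + rip (Z x) x).
  by rewrite WE ripZl ripDl.
split.
- split; last by rewrite addr_ge0 // mulr_ge0 // ?exprn_ge0 // ltW.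
    apply: vna_half; rewrite rpredD //; apply: vna_scale.
    by rewrite rpredM //; exact: vna_adjoint.
  apply/selfadjointP => x y; rewrite !WE ripZl ripZr ripDl ripDr Zs.
  by rewrite ((selfadjointP X).1 Xs).
- move=> x xN; rewrite WE ZE XN // xN; last by apply: sC; rewrite in_cons eqxx.
  by rewrite linear0 scaler0 addr0 scaler0.
- move=> x; rewrite ripW WE rnormZ ?invr_ge0 //.
  have h1 := rnormD (X x) (Z x); have h2 := Xpos x; have h3 := Zpos x.
  have h4 := rnorm_ge0 (X x + Z x).
  have h5 : rnorm (X x + Z x) ^+ 2 <= (rnorm (X x) + rnorm (Z x)) ^+ 2.
    by rewrite ler_pXn2r ?nnegrE ?addr_ge0 ?rnorm_ge0.
  have h6 := sqr_ge0 (rnorm (X x) - rnorm (Z x)).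
  by rewrite exprMn; move: h2 h3 h5 h6; rewrite !expr2; lra.
- have k2 : 0 <= k ^+ 2 by rewrite exprn_ge0 // ltW.
  move=> d x; rewrite ripW in_cons.
  have X0 := le_trans (sqr_ge0 _) (Xpos x).
  have Z0 := le_trans (sqr_ge0 _) (Zpos x).
  have h1 := mulr_ge0 b0 X0; have h2 := mulr_ge0 b0 Z0.
  have h3 := mulr_ge0 k2 X0; have h4 := mulr_ge0 k2 Z0.
  move=> /predU1P[->|/(Xdom d x) h]; last by lra.
  have -> : rnorm (c x) ^+ 2 = k ^+ 2 * rip (Z x) x.
    by rewrite ripZ mulrA mulfV ?mul1r // expf_neq0 // gt_eqF.
  lra.
Qed.

(** A is the mean of the powers 1, u, ..., u ^ n of the contraction u = 1 - X.  As
    (1 - u) (1 + u + ... + u ^ n) = 1 - u ^ (n + 1), the operator X A has norm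
    at most 2 / (n + 1). *)
Lemma cesaro_means (X : 'B(H)) n : X \in vna_pred M -> star X = X ->
  (forall x, rnorm (X x) ^+ 2 <= rip (X x) x) ->
  exists A : 'B(H), [/\ A \in vna_pred M, star A = A, contraction A,
    forall x, X x = 0 -> A x = x &
    forall x, n.+1%:R * rnorm (X (A x)) <= 2 * rnorm x].
Proof.
move=> XM Xs Xpos; pose u := 1 - X.
have us : star u = u by rewrite starB star1 Xs.
have uc : contraction u.
  move=> x; rewrite -(@ler_pXn2r _ 2) ?nnegrE ?rnorm_ge0 // -!ripE.
  rewrite /u !bopE !rip_linear (ripC x (X x)) !(ripE (X x)). have := Xpos x; have := sqr_ge0 (rnorm (X x)); lra.
have [T [W [[TM Ts uT] Wc XT Tb TN]]] : exists T W : 'B(H),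
    [/\ [/\ T \in vna_pred M, star T = T & u * T = T * u], contraction W,
      X * T = 1 - W, forall x, rnorm (T x) <= n.+1%:R * rnorm x &
      forall x, X x = 0 -> T x = n.+1%:R *: x].
  elim: n => [|n [T [W [[TM Ts uT] Wc XT Tb TN]]]].
    exists 1, u; split=> //.
    - by split; [exact: rpred1|exact: star1|exact: commr1].
    - by rewrite mulr1 /u opprB addrC subrK.
    - by move=> x; rewrite mulr1n mul1r.
    - by move=> x _; rewrite mulr1n scale1r.
  exists (1 + u * T), (u * W); split.
  - split; last first.
      have -> : u * (1 + u * T) = (1 + u * T) * u + u * (u * T - T * u) by ncring.
      by rewrite uT subrr mulr0 addr0.
    + by rewrite starD star1 starM us Ts uT.
    + by rewrite rpredD ?rpredM ?rpred1 // rpredB // rpred1.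
  - by move=> x; apply: le_trans (uc _) (Wc _).
  - have -> : X * (1 + u * T) = X + u * (X * T) by rewrite /u; ncring.
    by rewrite XT /u; ncring.
  - move=> x; have h := le_trans (uc (T x)) (Tb x).
    have h' : rnorm ((1 + u * T) x) <= rnorm x + rnorm (u (T x)) := rnormD _ _.
    rewrite -natr1; lra.
  - move=> x xN; have -> : (1 + u * T) x = x + (T x - X (T x)) by [].
    rewrite TN // linearZ /= xN scaler0 subr0.
    by rewrite -[X in X + _]scale1r -scalerDl nat1r.
pose k : R := n.+1%:R^-1; have k0 : 0 <= k by rewrite invr_ge0 ler0n.
have nk : n.+1%:R * k = 1 by rewrite mulfV // pnatr_eq0.
exists (k%:C *: T).
have E x : (k%:C *: T) x = k%:C *: T x by [].
split.
- exact: vna_scale.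
- by apply/selfadjointP => x y; rewrite !E ripZl ripZr ((selfadjointP T).1 Ts).
- move=> x; rewrite E rnormZ // -[leRHS]mul1r -nk (mulrC n.+1%:R) -mulrA.
  by rewrite ler_wpM2l.
- move=> x xN; rewrite E TN // scalerA.
  have -> : k%:C * n.+1%:R = 1 :> R[i].
    by rewrite -(rmorph_nat (real_complex R)) -rmorphM mulrC nk rmorph1.
  exact: scale1r.
- move=> x; rewrite E linearZ /= rnormZ // mulrA nk mul1r.
  have -> : X (T x) = x - W x by rewrite -[LHS]/((X * T) x) XT.
  have := rnormB x (W x); have := Wc x; lra.
Qed.

Lemma approximate_kernel_projection (C : set 'B(H)) (s : seq 'B(H)) (e : R) :
  (forall c, C c -> c \in vna_pred M) -> (forall c, c \in s -> C c) -> 0 < e ->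
  exists A : 'B(H), [/\ A \in vna_pred M, star A = A, contraction A,
    forall x, (forall c, C c -> c x = 0) -> A x = x &
    forall c x, c \in s -> rnorm (c (A x)) <= e * rnorm x].
Proof.
move=> CM sC e0.
have [X [b [[XM Xs b0] XN Xpos Xdom]]] := dominating_operator CM sC.
(* |c A x| ^ 2 <= b <X A x, A x> <= 2 b / (n + 1) |x| ^ 2 *)
pose n := Num.bound (2 * b / e ^+ 2).
have [A [AM As Ac AN XA]] := cesaro_means n XM Xs Xpos.
exists A; split=> // [x /XN|c x cs]; first exact: AN.
have nb : 2 * b <= n.+1%:R * e ^+ 2.
  rewrite -ler_pdivrMr ?exprn_gt0 //; apply: ltW.
  have /archi_boundP := divr_ge0 (mulr_ge0 (ler0n R 2) b0) (sqr_ge0 e).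
  by move=> /lt_le_trans; apply; rewrite ler_nat.
rewrite -(@ler_pXn2r _ 2) ?nnegrE ?mulr_ge0 ?rnorm_ge0 ?(ltW e0) //.
apply: le_trans (Xdom c (A x) cs) _.
have h : n.+1%:R * rip (X (A x)) (A x) <= 2 * rnorm x ^+ 2.
  have h1 := rip_le (X (A x)) (A x).
  apply: (@le_trans _ _ (n.+1%:R * (rnorm (X (A x)) * rnorm (A x)))).
    by rewrite ler_wpM2l.
  rewrite mulrA expr2 mulrA; apply: ler_pM => //; rewrite ?rnorm_ge0 //.
  by rewrite mulr_ge0 ?rnorm_ge0.
rewrite -(@ler_pM2l _ n.+1%:R) // mulrCA exprMn.
apply: (le_trans (ler_wpM2l b0 h)).
by rewrite mulrA (mulrC b) (mulrA n.+1%:R) ler_wpM2r ?sqr_ge0.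
Qed.

(** Weak limit of the approximate projections of
    [approximate_kernel_projection], as s exhausts C and e tends to 0. *)
Lemma vna_kernel_projection (C : set 'B(H)) :
  (forall c, C c -> c \in vna_pred M) ->
  exists E : 'B(H), [/\ E \in vna_pred M, star E = E, E * E = E &
    forall x, E x = x <-> forall c, C c -> c x = 0].
Proof.
move=> CM.
(* Finite subsets s of C and tolerances e index the approximations. *)
pose D := [set p : seq 'B(H) * R | (forall c, c \in p.1 -> C c) /\ 0 < p.2].
pose S (p : seq 'B(H) * R) := [set A : 'B(H) |
  [/\ A \in vna_pred M, star A = A, contraction A,
    forall x, (forall c, C c -> c x = 0) -> A x = x &
    forall c x, c \in p.1 -> rnorm (c (A x)) <= p.2 * rnorm x]].
have FF : ProperFilter (filter_from D S).
  apply: filter_from_proper; last first.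
    by move=> [s e] [sC e0]; exact: (approximate_kernel_projection CM sC e0).
  apply: filter_from_filter; first by exists ([::], 1); split.
  move=> [s e] [s' e'] [/= sC e0] [/= sC' e0'].
  exists (s ++ s', Num.min e e') => /=.
    split=> /= [c|]; last by rewrite lt_min e0.
    by rewrite mem_cat => /orP[/sC|/sC'].
  move=> A [AM As Ac AN Ae]; split; split=> // c x cs.
    have := Ae c x; rewrite mem_cat cs => /(_ isT) h; apply: le_trans h _.
    by rewrite ler_wpM2r ?rnorm_ge0 // ge_min lexx.
  have := Ae c x; rewrite mem_cat cs orbT => /(_ isT) h; apply: le_trans h _.
  by rewrite ler_wpM2r ?rnorm_ge0 // ge_min lexx orbT.
have F1 : filter_from D S (S ([::], 1)) by exists ([::], 1) => //; split.
have [|G [E [GU FG GE]]] := @weak_limit _ _ _ 1 FF.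
  by apply: filterS F1 => A [_ _ Ac _ _] x; rewrite mul1r.
have {}F1 := FG _ F1.
have EM : E \in vna_pred M.
  by apply: vna_weak_limit GE; apply: filterS F1 => A [].
have rip_le_lim x y r : G [set A : 'B(H) | rip (A x) y <= r] -> rip (E x) y <= r.
  by move=> h; apply: (cvgr_to_le (GE x y)).
have Es : star E = E.
  have le_sym x y : rip (E x) y <= rip (E y) x.
    rewrite -subr_le0; apply: (cvgr_to_le (cvgB (GE x y) (GE y x))).
    have : G [set A : 'B(H) | rip (A x) y - rip (A y) x <= 0].
      apply: filterS F1 => A [_ As _ _ _] /=.
      by rewrite ((selfadjointP A).1 As) ripC subrr.
    by [].
  apply/selfadjointP => x y; apply/eqP.
  by rewrite (ripC x) eq_le !le_sym.
have EN x : (forall c, C c -> c x = 0) -> E x = x.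
  move=> xN; have le_x y : rip (E x) y <= rip x y.
    by apply: rip_le_lim; apply: filterS F1 => A [_ _ _ AN _] /=; rewrite AN.
  apply: rip_inj => y; apply/eqP; rewrite eq_le le_x /=.
  by have := le_x (- y); rewrite !ripNr lerN2.
have CE c x : C c -> c (E x) = 0.
  move=> Cc; set z := c (E x).
  have h e : 0 < e -> rnorm z ^+ 2 <= rnorm x * rnorm z * e.
    move=> e0; rewrite -ripE {1}/z rip_star; apply: rip_le_lim; apply: FG.
    exists ([:: c], e).
      by split=> //= d; rewrite inE => /eqP ->.
    move=> A [_ _ _ _ Ae] /=; rewrite -rip_star.
    apply: le_trans (rip_le _ _) _.
    have := ler_wpM2r (rnorm_ge0 z) (Ae c x _); rewrite inE eqxx => /(_ isT).
    rewrite /=; lra.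
  apply: rnorm_eq0; apply/eqP; rewrite -sqrf_eq0 eq_le sqr_ge0 andbT.
  by apply: le_eps h; rewrite mulr_ge0 ?rnorm_ge0.
exists E; split=> //; first by apply: bopP => x; apply: EN => c; exact: CE.
by move=> x; split=> [<- c|]; [exact: CE|exact: EN].
Qed.

End Operators.

(** * Algebras whose projections are central *)

Section Commutation.
Variables (R : realType) (H : hilbertType R) (M : vonNeumannAlgebra H).
Implicit Types (x y z : H) (A B a b : 'B(H)).

Lemma rip_contraction_sqr a x : star a = a -> contraction a ->
  rnorm (a (a x)) <= rnorm (a x) /\ rip (a (a x)) x = rnorm (a x) ^+ 2.
Proof. by move=> sa ca; split; [exact: ca|rewrite rip_star sa ripE]. Qed.

(** s = sqrt (1 - u) for u = 1 - a ^ 2.  The last property, s ^ 2 <= s, holds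
    since 0 <= s <= 1; it is proved with a square root w of s. *)
Lemma vna_abs a : a \in vna_pred M -> star a = a -> contraction a ->
  exists s : 'B(H), [/\ s \in vna_pred M, star s = s, s * s = a * a,
    s * a = a * s & forall x, rnorm (s x) ^+ 2 <= rip (s x) x].
Proof.
move=> aM sa ca; pose u := 1 - a * a.
have su : star u = u by rewrite starB star1 starM sa.
have uM : u \in vna_pred M by rewrite rpredB ?rpred1 // rpredM.
have cu : contraction u.
  move=> x; rewrite -(@ler_pXn2r _ 2) ?nnegrE ?rnorm_ge0 // -!ripE.
  have -> : u x = x - a (a x) by [].
  have := rnorm_ge0 (a (a x)); have [] := rip_contraction_sqr x sa ca.
  rewrite !rip_linear (ripC x (a _)) (ripE (a (a x))) => + -> +; nra.
have [y [yM sy cy yy yC]] := vna_sqrt uM su cu.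
have [z [zM sz cz zz zC]] := vna_sqrt yM sy cy.
have ua : u * a = a * u by rewrite /u; ncring.
have ss : (1 - y) * (1 - y) = a * a.
  have -> : (1 - y) * (1 - y) = 1 - (y + y) + y * y by ncring.
  by rewrite yy /u; ncring.
have ww : (1 - z) * (1 - z) = 1 - y.
  have -> : (1 - z) * (1 - z) = 1 - (z + z) + z * z by ncring.
  by rewrite zz; ncring.
have zy : z * y = y * z by exact: zC.
have ws : (1 - z) * (1 - y) = (1 - y) * (1 - z).
  have -> : (1 - z) * (1 - y) = 1 - z - y + z * y by ncring.
  by rewrite zy; ncring.
exists (1 - y); split=> //.
- by rewrite rpredB ?rpred1.
- by rewrite starB star1 sy.
- by rewrite mulrBl mulrBr yC // mul1r mulr1.
move=> x; set s := 1 - y in ss ws ww *; set w := 1 - z in ws ww *.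
have sw : star w = w by rewrite starB star1 sz.
have sss : star s = s by rewrite starB star1 sy.
have sx v : s v = w (w v) by rewrite -ww.
have ns v : rnorm (s v) = rnorm (a v).
  apply/eqP; rewrite -(@eqrXn2 _ 2) ?rnorm_ge0 // -!ripE !rip_star sss sa.
  by rewrite -[s (s v)]/((s * s) v) ss.
have -> : rip (s x) x = rnorm (w x) ^+ 2 by rewrite sx rip_star sw ripE.
have -> : rnorm (s x) ^+ 2 = rip (w x) (s (w x)).
  rewrite -ripE {1}sx rip_star sw; congr (rip _ _).
  by rewrite -[LHS]/((w * s) x) ws.
apply: le_trans (rip_le _ _) _; rewrite expr2 ler_wpM2l ?rnorm_ge0 //.
by rewrite ns.
Qed.

(** With s the absolute value of a and E the projection onto the kernel of s - a,
    the reflection J = 2 E - 1 satisfies a = s J: it is the sign of a.  Then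
    2 a - J = (2 s - 1) J is a contraction because 0 <= s <= 1. *)
Lemma vna_sign a : a \in vna_pred M -> star a = a -> contraction a ->
  exists E : 'B(H), [/\ E \in vna_pred M, star E = E, E * E = E &
    contraction (a + a - (E + E - 1))].
Proof.
move=> aM sa ca; have [s [sM ss s2 sC s_pos]] := vna_abs aM sa ca.
have [c|E [EM Es EE EP]] := @vna_kernel_projection _ _ M [set s - a].
  by move=> ->; rewrite rpredB.
have sE : s * E = a * E.
  apply/subr0_eq; rewrite -mulrBl; apply: bopP => x.
  by have /EP := congr1 (fun A : 'B(H) => A x) EE; apply.
have Es' : E * s = E * a by rewrite -{1}ss -sa -Es -!starM sE.
have Esa : E * (s + a) = s + a.
  apply: bopP => x; apply/EP => _ ->.
  have -> : (s - a) ((s + a) x) = ((s - a) * (s + a)) x by [].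
  have -> : (s - a) * (s + a) = s * s - a * a + (s * a - a * s) by ncring.
  by rewrite s2 sC !subrr addr0.
have EEs : E * s + E * s = s + a by rewrite -Esa mulrDr {2}Es'.
have sEE : s * E + s * E = s + a.
  by have := congr1 star EEs; rewrite !starD !starM ss sa Es.
pose J := E + E - 1.
have Js : star J = J by rewrite starB starD Es star1.
have JJ : J * J = 1.
  have -> : J * J = (E * E - E) + (E * E - E) + (E * E - E) + (E * E - E) + 1.
    by rewrite /J; ncring.
  by rewrite EE !subrr !add0r.
have sJ : s * J = a.
  have -> : s * J = (s * E + s * E) - s by rewrite /J; ncring.
  by rewrite sEE addrC addKr.
exists E; split=> //; rewrite -/J => x.
have -> : (a + a - J) x = s (J x) + s (J x) - J x by rewrite -{1 2}sJ.
have -> : rnorm x = rnorm (J x).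
  apply/eqP; rewrite -(@eqrXn2 _ 2) ?rnorm_ge0 // -!ripE rip_star Js.
  by rewrite -[J (J x)]/((J * J) x) JJ.
rewrite -(@ler_pXn2r _ 2) ?nnegrE ?rnorm_ge0 //; have := s_pos (J x).
move: (J x) => v; rewrite -!ripE !rip_linear (ripC v (s v)); lra.
Qed.

Definition commutes_with_projections x :=
  forall E b, E \in vna_pred M -> star E = E -> E * E = E -> b \in vna_pred M ->
  E (b x) = b (E x).

(** Replacing a by 2 a - (2 E - 1), which is again a selfadjoint contraction,
    doubles the commutator with b at x.  As commutators with contractions are
    bounded, this one vanishes. *)
Lemma contraction_commutes a b x : commutes_with_projections x ->
  a \in vna_pred M -> star a = a -> contraction a -> b \in vna_pred M ->
  a (b x) = b (a x).
Proof.
move=> xP aM sa ca bM; have [c c0 bc] := bop_rbounded b.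
have dyadic m : forall a, a \in vna_pred M -> star a = a -> contraction a ->
    2 ^+ m * rnorm (a (b x) - b (a x)) <= 2 * c * rnorm x.
  elim: m => [|m IH] {aM sa ca}a aM sa ca.
    rewrite expr0 mul1r; apply: le_trans (rnormB _ _) _.
    have := ca (b x); have := bc x; have := bc (a x); have := ca x; nra.
  have [E [EM Es EE ca']] := vna_sign aM sa ca.
  have sa' : star (a + a - (E + E - 1)) = a + a - (E + E - 1).
    by rewrite !(starB, starD, star1) sa Es.
  have a'M : a + a - (E + E - 1) \in vna_pred M.
    by rewrite !(rpredB, rpredD, rpred1).
  have := IH _ a'M sa' ca'.
  have -> : (a + a - (E + E - 1)) (b x) - b ((a + a - (E + E - 1)) x) =
      2%:C *: (a (b x) - b (a x)).
    have -> A : A (b x) - b (A x) = (A * b - b * A) x by [].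
    have -> : (a + a - (E + E - 1)) * b - b * (a + a - (E + E - 1)) =
      (a * b - b * a) + (a * b - b * a) - ((E * b - b * E) + (E * b - b * E)).
      by ncring.
    set z := (X in X = _).
    have {z}-> : z = (a (b x) - b (a x)) + (a (b x) - b (a x)) -
      ((E (b x) - b (E x)) + (E (b x) - b (E x))) by [].
    by rewrite (xP E b) // !subrr addr0 subr0 rmorphD rmorph1 scalerDl scale1r.
  by rewrite rnormZ // mulrA exprSr.
apply/subr0_eq/rnorm_eq0/eqP; rewrite eq_le rnorm_ge0 andbT leNgt.
apply/negP => r0; set r := rnorm _ in r0.
pose m := Num.bound (2 * c * rnorm x / r).
have h := dyadic m a aM sa ca; rewrite -/r in h.
have : 2 * c * rnorm x / r < 2 ^+ m.
  have /archi_boundP : 0 <= 2 * c * rnorm x / r.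
    by rewrite divr_ge0 ?mulr_ge0 ?rnorm_ge0 // ltW.
  by move=> /lt_trans; apply; rewrite -natrX ltr_nat ltn_expl.
by rewrite ltr_pdivrMr // ltNge h.
Qed.

Lemma selfadjoint_commutes a b x : commutes_with_projections x ->
  a \in vna_pred M -> star a = a -> b \in vna_pred M -> a (b x) = b (a x).
Proof.
move=> xP aM sa bM; have [c c0 ac] := bop_rbounded a.
have ci : 0 <= c^-1 by rewrite invr_ge0 ltW.
have ca : contraction ((c^-1)%:C *: a).
  move=> y; rewrite bopZE rnormZ // mulrC ler_pdivrMr // mulrC; exact: ac.
have sca : star ((c^-1)%:C *: a) = (c^-1)%:C *: a.
  by apply/selfadjointP => y z; rewrite !bopZE ripZl ripZr rip_star sa.
have := contraction_commutes xP (vna_scale _ aM) sca ca bM.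
rewrite !bopZE linearZ => /(congr1 ( *:%R c%:C)).
by rewrite !scalerA -rmorphM mulfV ?gt_eqF // !scale1r.
Qed.

Lemma star_im a : star ('i *: a) = - ('i *: star a).
Proof.
apply: bopP => y; apply: rip_inj => x.
rewrite rip_starl !bopE ripNl /rip innerZr innerZl.
have -> : inner (star a y) x = inner y (a x).
  rewrite innerC (_ : inner x (star a y) = inner (a x) y) -?innerC //.
  exact/esym/adjointP.
by case: (inner y (a x)) => p q /=; lra.
Qed.

Lemma vna_commutes a b x : commutes_with_projections x ->
  a \in vna_pred M -> b \in vna_pred M -> a (b x) = b (a x).
Proof.
move=> xP aM bM; have aM' := vna_adjoint aM.
pose re := a + star a; pose im := 'i *: (star a - a).
have reM : re \in vna_pred M by exact: rpredD.
have imM : im \in vna_pred M by apply: vna_scale; exact: rpredB.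
have res : star re = re by rewrite starD starK addrC.
have ims : star im = im by rewrite star_im starB starK -scalerN opprB.
have h1 := selfadjoint_commutes xP reM res bM.
have h2 := selfadjoint_commutes xP imM ims bM.
have ii z : 'i *: ('i *: z) = - z :> H.
  by rewrite scalerA -expr2 sqr_i scaleN1r.
have aE z : a z + a z = re z + 'i *: im z.
  by rewrite !bopE ii opprB addrACA subrr addr0.
have bL u z : b (u + 'i *: z) = b u + 'i *: b z by rewrite linearD linearZ.
have bD u : b (u + u) = b u + b u by rewrite linearD.
have double_inj (u w : H) : u + u = w + w -> u = w.
  have two_neq0 : (1 + 1 : R[i]) != 0 by rewrite -(natrD _ 1 1) pnatr_eq0.
  by move=> h; apply: (scalerI two_neq0); rewrite !scalerDl !scale1r.
clearbody re im; apply: double_inj.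
by rewrite -bD (aE (b x)) (aE x) h1 h2 bL.
Qed.

Lemma vna_valM (s t : M) : vna_val (s * t) = vna_val s * vna_val t.
Proof. exact: (rmorphM \val). Qed.

Lemma vna_valB (s t : M) : vna_val (s - t) = vna_val s - vna_val t.
Proof. exact: (rmorphB \val). Qed.

Lemma vna_valN (s : M) : vna_val (- s) = - vna_val s.
Proof. exact: (rmorphN \val). Qed.

(** * Faithfulness of the commutators with projections *)

(** The projection F onto the common kernel of the commutators [p y - y p] is
    central and abelian, hence zero. *)
Lemma commutators_faithful (T : 'B(H)) :
  without_typeI1_central_summands M ->
  (forall p y : M, projection p -> T * vna_val (p * y - y * p) = 0) -> T = 0.
Proof.
move=> noI1 hT.
pose C := [set c : 'B(H) | exists p y : M, projection p /\ c = vna_val (p * y - y * p)].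
have [c [p [y [_ ->]]]|F [FM Fs FF FP]] := @vna_kernel_projection _ _ M C.
  exact: vna_valP.
have FN x : commutes_with_projections (F x).
  move=> E b EM Es EE bM; have := (FP (F x)).1 (congr1 (fun A : 'B(H) => A x) FF).
  pose p := VnaElt EM; pose y := VnaElt bM.
  move=> /(_ (vna_val (p * y - y * p))) h; apply/subr0_eq/h.
  exists p, y; split=> //; split; exact: val_inj.
have FI x a : a \in vna_pred M -> F (a (F x)) = a (F x).
  move=> aM; apply/FP => _ [p [y [pP ->]]]; pose t : M := VnaElt aM.
  have h (w : M) : vna_val (p * w - w * p) (F x) = 0.
    apply: (FP (F x)).1; first exact: (congr1 (fun A : 'B(H) => A x) FF).
    by exists p, w.
  have e : (p * y - y * p) * t = (p * (y * t) - (y * t) * p) - y * (p * t - t * p).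
    by ncring.
  have /(congr1 (fun A : 'B(H) => A (F x))) : vna_val (p * y - y * p) * a =
      vna_val (p * (y * t) - (y * t) * p) - vna_val y * vna_val (p * t - t * p).
    by rewrite -[a]/(vna_val t) -!vna_valM -vna_valB e.
  by rewrite bopME => ->; rewrite bopDE bopNE bopME !h linear0 subr0.
have FaF a : a \in vna_pred M -> F * a = a * F.
  have h b : b \in vna_pred M -> F * b * F = b * F.
    by move=> bM; apply: bopP => x; exact: FI.
  move=> aM; rewrite -(h a aM) -[LHS]starK starM Fs.
  by rewrite -(h _ (vna_adjoint aM)) !starM !Fs starK mulrA.
pose f : M := VnaElt FM.
(* If f = 0, the commutators have no common kernel, but T^* maps into it. *)
have [f0|f0] := eqVneq f 0.
  have F0 : F = 0 by exact: (congr1 (@vna_val _ _ _) f0).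
  rewrite -(starK T) (_ : star T = 0) ?star0 //; apply: bopP => x.
  have /FP : forall c, C c -> c (star T x) = 0.
    move=> _ [p [y [pP ->]]].
    have h : vna_val (y * p - p * y) * star T = 0.
      have := congr1 star (hT p (star y) pP); rewrite starM star0.
      rewrite -[star (vna_val _)]/(vna_val (star (p * star y - star y * p))).
      by rewrite starB !starM starK pP.2.
    by rewrite -bopME -(opprB (y * p)) vna_valN mulNr h oppr0.
  by rewrite F0 => <-.
(* Otherwise f is the unit of an abelian central summand. *)
case: noI1; exists f.
have fP : projection f by split; exact: val_inj.
have fC (a : M) : f * a = a * f by apply: val_inj; exact: FaF (vna_valP a).
split=> //; split=> // a b.
have e (c : M) : f * c * f = c * f by rewrite fC -mulrA fP.1.
rewrite !e -!mulrA (mulrA f b) e (mulrA f a) e.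
apply: val_inj; apply: bopP => x.
exact: vna_commutes (FN x) (vna_valP a) (vna_valP b).
Qed.

End Commutation.

Lemma leibniz_sum_tuple (R : realType) (H : hilbertType R)
    (A : vonNeumannAlgebra H) (n : nat) (delta : A -> 'B(H)) (a : n.-tuple A) :
  \sum_(k < n) jordan_poly
    [tuple if i == k then delta (tnth a i) else vna_val (tnth a i) | i < n] =
  leibniz_sum (\val : {rmorphism A -> 'B(H)}) delta a.
Proof.
rewrite /leibniz_sum size_tuple; apply: eq_bigr => k _; congr jordan_poly.
apply: (@eq_from_nth _ 0) => [|i]; rewrite ?size_mkseq size_tuple // => ilt.
pose j := Ordinal ilt; rewrite nth_mkseq // (_ : i = j) //.
by rewrite -!tnth_nth tnth_mktuple.
Qed.

Theorem theorem3p1 (R : realType) (H : hilbertType R)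
    (A : vonNeumannAlgebra H) (n : nat) (delta : A -> 'B(H)) :
  without_typeI1_central_summands A -> (2 <= n)%N ->
  (forall a : n.-tuple A,
     delta (jordan_poly a) =
     \sum_(k < n) jordan_poly
       [tuple if i == k then delta (tnth a i) else vna_val (tnth a i) | i < n])
  <-> additive_star_derivation delta.
Proof.
move=> noI1 n2; pose v : {rmorphism A -> 'B(H)} := \val.
have v_star (a : A) : v (star a) = star (v a) by [].
split=> [hd|[dD dM dS] a]; last first.
  rewrite leibniz_sum_tuple (leibniz_sum_derivation v_star) //.
    move=> x y; rewrite /diamond dD !dM dS -addrA -addrA; congr (_ + _).
    by rewrite addrA addrC.
  by rewrite -size_eq0 size_tuple -lt0n (ltn_trans _ n2).
have hs s : size s = n -> delta (jordan_poly s) = leibniz_sum v delta s.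
  move=> sn; by have := hd (Tuple (introT eqP sn)); rewrite leibniz_sum_tuple.
have oneA : (1 : 'B(H)) \in vna_pred A by exact: rpred1.
pose half : A := VnaElt (vna_scale (2^-1)%:C oneA).
pose im : A := VnaElt (vna_scale 'i oneA).
have vhalf : v half = (2^-1)%:C *: (1 : 'B(H)) by [].
have vim : v im = 'i *: (1 : 'B(H)) by [].
have half_central x : v half * x = x * v half.
  by rewrite vhalf bopZAl bopZAr mul1r mulr1.
have im_central x : v im * x = x * v im by rewrite vim bopZAl bopZAr mul1r mulr1.
have v_inj : injective v by exact: val_inj.
have halfD : half + half = 1.
  apply: v_inj; rewrite rmorphD rmorph1 vhalf -scalerDl -rmorphD.
  have -> : 2^-1 + 2^-1 = 1 :> R by lra.
  by rewrite rmorph1 scale1r.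
have half_star : star half = half.
  apply: v_inj; rewrite v_star vhalf; apply/selfadjointP => x y.
  by rewrite !bopE ripZl ripZr.
have im_star : star im = - im.
  by apply: v_inj; rewrite v_star rmorphN vim star_im star1.
have im_sqr : im * im = -1.
  apply: v_inj; rewrite rmorphM rmorphN rmorph1 vim bopZAl mul1r scalerA.
  by rewrite -expr2 sqr_i scaleN1r.
have torsion_free (x : 'B(H)) m : x *+ m.+1 = 0 -> x = 0.
  rewrite -scaler_nat => /eqP; rewrite scaler_eq0 pnatr_eq0 /=; exact: eqP.
have double_inj (x : 'B(H)) : x + x = 0 -> x = 0 by exact: (torsion_free x 1%N).
have faithful (x : 'B(H)) :
    (forall p y : A, star_projection p -> x * v (p * y - y * p) = 0) -> x = 0.
  by move=> h; apply: (commutators_faithful noI1) => p y pP; exact: h.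
have diamond_derivable := jordan_diamond v_star halfD half_star half_central
  torsion_free n2 hs v_inj.
exact: (diamond_derivable_star_derivation v_inj v_star im_star im_sqr im_central
  halfD double_inj faithful diamond_derivable).
Qed.
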